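(* Let $m\ge1$ and $a_1,\dots,a_m\in\mathbb{C}$. The Bisch–Jones planar (Fuss–Catalan) algebra $FC_n(a_1,\dots,a_m)$ is semisimple for all $n\ge1$ if and only if none of $a_1,\dots,a_m$ belongs to the set $$\{2\cos(\pi r)\;;\;r\in\mathbb{Q}\setminus\mathbb{Z}\}.$$
   Context: $FC_n(a_1,\dots,a_m)$ is the complex algebra with basis the following planar string diagrams: take a rectangle with $mn$ points on the top edge and $mn$ points on the bottom edge; the points of each row are colored, from left to right, by the first $mn$ letters of the periodic sequence $x_1x_2\cdots x_m\,x_m\cdots x_2x_1\,x_1x_2\cdots x_m\,x_m\cdots$ (blocks $x_1\cdots x_m$ and $x_m\cdots x_1$ alternating) in $m$ distinct colors $x_1,\dots,x_m$; a diagram is (the isotopy class of) a non-crossing perfect matching, inside the rectangle, of the $2mn$ boundary points such that matched points have the same color. The product of two diagrams is obtained by stacking them, each closed loop of color $x_j$ that is created being removed and replaced by the scalar factor $a_j$ (the evaluation parameter of $x_j$). *)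

(* Defs.v *)
From HB Require Import structures.
From mathcomp Require Import all_boot all_order all_algebra.
From mathcomp Require Import complex.
From mathcomp Require Import reals trigo.
Set Implicit Arguments.
Unset Strict Implicit.
Unset Printing Implicit Defensive.
Import Order.TTheory GRing.Theory Num.Theory.
Local Open Scope ring_scope.

(* The boundary points of a rectangle with N points on each horizontal edge:
   [inl i] is the i-th point of the top edge and [inr i] the i-th point of the
   bottom edge, both counted from the left, starting from 0. *)
Definition bpoint (N : nat) : finType := ('I_N + 'I_N)%type.

(* Colors are indexed by 0, ..., m - 1, so that the coloring of an edge reads
   0 1 ... m-1 | m-1 ... 1 0 | 0 1 ... m-1 | ... *)
Definition color (m k : nat) : nat :=
  if odd (k %/ m) then (m.-1 - k %% m)%N else (k %% m)%N.

Definition bcolor (m N : nat) (x : bpoint N) : nat :=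
  match x with inl i => color m i | inr i => color m i end.

(* Rank of a boundary point when one goes around the rectangle clockwise from
   the top left corner. *)
Definition bpos (N : nat) (x : bpoint N) : nat :=
  match x with inl i => i | inr i => ((2 * N).-1 - i)%N end.

Definition perfect_matching (N : nat) (d : {ffun bpoint N -> bpoint N}) : bool :=
  [forall x, (d x != x) && (d (d x) == x)].

Definition noncrossing (N : nat) (d : {ffun bpoint N -> bpoint N}) : bool :=
  ~~ [exists x, exists y,
        [&& bpos x < bpos y, bpos y < bpos (d x) & bpos (d x) < bpos (d y)]%N].

Definition color_preserving (m N : nat) (d : {ffun bpoint N -> bpoint N}) : bool :=
  [forall x, bcolor m (d x) == bcolor m x].

Record diagram (m n : nat) := Diagram {
  partner :> {ffun bpoint (m * n) -> bpoint (m * n)};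
  _ : [&& perfect_matching partner, noncrossing partner
        & color_preserving m partner]
}.

HB.instance Definition _ m n := [isSub for @partner m n].
HB.instance Definition _ m n := [Finite of diagram m n by <:].

Section Stacking.
Variables m n : nat.
Implicit Types (d : diagram m n) (x : bpoint (m * n)).

(* The points of two stacked rectangles: [(0, i)] on the top edge of the upper
   one, [(1, i)] on the common edge, [(2, i)] on the bottom edge of the lower
   one. *)
Definition spoint : finType := ('I_3 * 'I_(m * n))%type.

Definition top_row : 'I_3 := inord 0.
Definition mid_row : 'I_3 := inord 1.
Definition bot_row : 'I_3 := inord 2.

Definition upper x : spoint :=
  match x with inl i => (top_row, i) | inr i => (mid_row, i) end.
Definition lower x : spoint :=
  match x with inl i => (mid_row, i) | inr i => (bot_row, i) end.
Definition outer x : spoint :=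
  match x with inl i => (top_row, i) | inr i => (bot_row, i) end.

(* The strings of [d1] drawn in the upper rectangle and those of [d2] drawn in
   the lower one. *)
Definition strings d1 d2 : rel spoint := fun u v =>
  [exists x, (u == upper x) && (v == upper (d1 x))] ||
  [exists x, (u == lower x) && (v == lower (d2 x))].

(* [d] is the diagram obtained by stacking [d1] on top of [d2] and removing the
   closed loops. *)
Definition is_stacking d1 d2 d : bool :=
  [forall x, connect (strings d1 d2) (outer x) (outer (d x))].

Definition on_loop d1 d2 (i : 'I_(m * n)) : bool :=
  ~~ [exists x, connect (strings d1 d2) (mid_row, i) (outer x)].

(* A closed loop is identified with the set of points where it meets the common
   edge; these points all have the same color. *)
Definition loops d1 d2 (j : 'I_m) : {set {set 'I_(m * n)}} :=
  [set [set i' | connect (strings d1 d2) (mid_row, i) (mid_row, i')]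
     | i in [set i | on_loop d1 d2 i & color m i == j]].

End Stacking.

(* The vector space with basis the diagrams: [f : FC F m n] stands for the
   linear combination of the diagrams [d] with coefficients [f d]. *)
Definition FC (F : fieldType) (m n : nat) : vectType F :=
  {ffun diagram m n -> F^o}.

(* The bilinear extension of
   d1 * d2 = (\prod_j a_j ^ (number of loops of color j)) (stacking of d1, d2). *)
Definition FCmul (F : fieldType) (m n : nat) (a : 'I_m -> F)
    (f g : FC F m n) : FC F m n :=
  [ffun d => \sum_(d1 : diagram m n)
               \sum_(d2 : diagram m n | is_stacking d1 d2 d)
                 f d1 * g d2 * \prod_(j < m) a j ^+ #|loops d1 d2 j|].

Section Semisimple.
Variables (F : fieldType) (A : vectType F) (mul : A -> A -> A).

Definition left_ideal (U : {vspace A}) : Prop :=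
  forall x u : A, u \in U -> mul x u \in U.

Definition simple_left_ideal (U : {vspace A}) : Prop :=
  [/\ left_ideal U, U != 0%VS
    & forall W : {vspace A}, left_ideal W -> (W <= U)%VS -> W = 0%VS \/ W = U].

(* The finite-dimensional algebra [A] with product [mul] is semisimple as a left
   module over itself: it is a direct sum of simple submodules. *)
Definition semisimple : Prop :=
  exists (k : nat) (U : 'I_k -> {vspace A}),
    [/\ forall i, simple_left_ideal (U i),
        directv (\sum_(i < k) U i)
      & (\sum_(i < k) U i)%VS = fullv].

End Semisimple.

(* Main.v *)
Require Import Defs.
From HB Require Import structures.
From mathcomp Require Import all_boot all_order all_algebra.
From mathcomp Require Import complex.
From mathcomp Require Import reals trigo.
From mathcomp Require Import zify ring.
Set Implicit Arguments.
Unset Strict Implicit.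
Unset Printing Implicit Defensive.
Import Order.TTheory GRing.Theory Num.Theory.
Local Open Scope ring_scope.
Local Open Scope complex_scope.

(** Label the regions cut out by a diagram by words in the colours, the leftmost
    region by the empty word, in such a way that crossing a string of colour [c]
    appends or deletes a letter [c]. A diagram then becomes a matrix indexed by
    the sequences of regions met along its two horizontal edges: an entry is
    nonzero only if both sides of every string carry the same two regions, and is
    then a product of factors [mu (inside) / mu (outside)], one per arc. Here
    [mu^2] is multiplicative over the runs of a word, a run of [k] letters [c]
    having weight [U_k (a_c)], with [U_k] the Chebyshev polynomial such that
    [sin t * U_k (2 cos t) = sin ((k + 1) t)]. The recursion
    [U_(k+1) + U_(k-1) = a_c U_k] makes a closed loop of colour [c] contribute
    [a_c], so that this is a representation; only the words of nonzero weight are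
    used as regions.

    If no [U_k (a_c)] vanishes then every word is allowed. Each diagram has a
    highest region sequence, in which every opening string adds a letter; every
    closed sequence is the highest one of exactly one diagram, and the matrix of
    a diagram is triangular for this order. Hence the representation is an
    isomorphism onto a sum of matrix algebras, one per word.

    If [U_K (a_j) = 0], take [n = 2K]. There are fewer allowed closed sequences
    than half diagrams without through strings, so some nonzero combination [v]
    of half diagrams has vanishing state sums. For a half diagram [u] the element
    [y], with upper half [v] and lower half [u], satisfies [y x y = 0] for all
    [x], which is impossible in a semisimple algebra.

    Finally [U_k] has degree [k] and the [k] roots [2 cos (pi t / (k + 1))]. *)

(** * Dyck words *)

(* A noncrossing matching of the points of a line is encoded by its Dyck word:
   [true] opens an arc and [false] closes the last arc left open. *)
Inductive dyck : seq bool -> Prop :=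
| dyck_nil : dyck [::]
| dyck_ins u v : dyck (u ++ v) -> dyck (u ++ true :: false :: v).

(* [tev st D b]: the labels [b] agree at the two ends of every arc of [D], where
   [st] holds the labels of the arcs opened before [D]. *)
Fixpoint tev (st : seq nat) (D : seq bool) (b : seq nat) : bool :=
  match D, b with
  | [::], [::] => nilp st
  | true :: D', x :: b' => tev (x :: st) D' b'
  | false :: D', x :: b' =>
      if st is y :: st' then (x == y) && tev st' D' b' else false
  | _, _ => false
  end.

Lemma tev_size st D b : tev st D b -> size D = size b.
Proof.
elim: D st b => [|[] D IH] st [|x b] //=; first by move/IH->.
by case: st => // y st /andP[_ /IH->].
Qed.

(** The inserted arc pushes [x] and pops it at once, so [v] meets an unchanged stack. *)
Lemma tev_ins st u v bu x y bv : size bu = size u ->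
  tev st (u ++ true :: false :: v) (bu ++ x :: y :: bv) =
    (y == x) && tev st (u ++ v) (bu ++ bv).
Proof.
elim: u bu st => [|[] u IH] [|b bu] st //= [] E; first exact: IH.
by case: st => [|c st]; rewrite ?andbF // IH // andbCA.
Qed.

Lemma nseq_cat_cons (T : Type) k (x : T) s :
  nseq k.+1 x ++ s = nseq k x ++ x :: s.
Proof. by elim: k => //= k <-. Qed.

(** Pending arcs are replaced by leading letters [true]; a closing letter then forms with the last
    of them an adjacent pair, which [dyck_ins] inserts. *)
Lemma tev_dyck_st st D b : tev st D b -> dyck (nseq (size st) true ++ D).
Proof.
elim: D st b => [|z D IH] st [|x b] //=; try by case: z.
  by case: st => // _; exact: dyck_nil.
case: z => [/IH|] /=; first by rewrite -nseq_cat_cons.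
by case: st => // y st /andP[_ /IH H]; rewrite nseq_cat_cons; exact: dyck_ins.
Qed.

Lemma tev_dyck D b : tev [::] D b -> dyck D.
Proof. exact: tev_dyck_st. Qed.

Lemma split_pair (T : Type) k (s : seq T) : (k.+2 <= size s)%N ->
  exists u x y v, s = u ++ x :: y :: v /\ size u = k.
Proof.
move=> le_k; exists (take k s); rewrite size_takel; last by lia.
move: (size_drop k s) (cat_take_drop k s).
case: (drop k s) => [|x [|y v]] /= Es; [exfalso; lia|exfalso; lia|].
by move=> Ec; exists x, y, v; rewrite Ec.
Qed.

(** The arcs of a Dyck word end inside it, so [D2] starts from the same stack [st] as [D1]. *)
Lemma tev_cat st D1 D2 b1 b2 : dyck D1 -> size b1 = size D1 ->
  tev st (D1 ++ D2) (b1 ++ b2) = tev [::] D1 b1 && tev st D2 b2.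
Proof.
move=> dD; elim: dD b1 => [|u v _ IH] b1; first by case: b1.
rewrite !size_cat /= => Eb.
have [|bu [x [y [bv [Eb1 Eu]]]]] := @split_pair _ (size u) b1; first by lia.
rewrite {}Eb1 in Eb *; rewrite -!catA /= !tev_ins // !catA IH ?andbA //.
by move: Eb; rewrite !size_cat /=; lia.
Qed.

(* [contr i D D' e]: joining the two adjacent endpoints [i] and [i + 1] of [D]
   gives [D'], and [e] tells whether this closes a loop. *)
Inductive contr : nat -> seq bool -> seq bool -> bool -> Prop :=
| contr_loop u v : contr (size u) (u ++ true :: false :: v) (u ++ v) true
| contr_zigl u z v :
    contr (size u) (u ++ z :: true :: false :: v) (u ++ z :: v) false
| contr_zigr u z v :
    contr (size u).+1 (u ++ true :: false :: z :: v) (u ++ z :: v) false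
| contr_farr i u v u' v' e : contr i (u ++ v) (u' ++ v') e ->
    (i.+2 <= size u)%N -> size u' = (size u - 2)%N ->
    contr i (u ++ true :: false :: v) (u' ++ true :: false :: v') e
| contr_farl i u v u' v' e : contr i (u ++ v) (u' ++ v') e ->
    (size u <= i)%N -> size u' = size u ->
    contr i.+2 (u ++ true :: false :: v) (u' ++ true :: false :: v') e.

Lemma contr_size i D D' e : contr i D D' e -> size D = (size D').+2.
Proof.
by elim=> [u v|u z v|u z v|{}i u v u' v' {}e _|{}i u v u' v' {}e _];
  rewrite !size_cat /=; lia.
Qed.

(** Induction on the insertions. The pair [i], [i + 1] lies left of the inserted arc, meets only its
    left end, is the arc itself, meets only its right end, or lies right of it: these are the five
    constructors of [contr]. *)
Lemma contr_ex i D : dyck D -> (i.+2 <= size D)%N ->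
  exists D' e, contr i D D' e.
Proof.
move=> dD; elim: dD i => [|u v _ IH] i //; rewrite size_cat /= => le_i.
have [lt_iu|] := ltnP i.+1 (size u).
  have [|D' [e cD']] := IH i; first by rewrite size_cat; lia.
  have := contr_size cD'; rewrite size_cat => sD'.
  exists (take (size u - 2) D' ++ true :: false :: drop (size u - 2) D'), e.
  by apply: contr_farr; rewrite ?cat_take_drop ?size_takel //; lia.
rewrite leq_eqVlt => /orP[/eqP Eu|].
  case/lastP: u Eu IH le_i => // u z; rewrite size_rcons => -[<-] _ _.
  by rewrite cat_rcons; exists (u ++ z :: v), false; exact: contr_zigl.
rewrite ltnS leq_eqVlt => /orP[/eqP<-|].
  by exists (u ++ v), true; exact: contr_loop.
rewrite leq_eqVlt => /orP[/eqP Ei|lt_ui].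
  case: v IH le_i => [|z v] _ le_i; first by exfalso; move: le_i; rewrite /=; lia.
  by rewrite -Ei; exists (u ++ z :: v), false; exact: contr_zigr.
case: i le_i lt_ui => [|[|i]] // le_i lt_ui.
have [|D' [e cD']] := IH i; first by rewrite size_cat; lia.
have := contr_size cD'; rewrite size_cat => sD'.
exists (take (size u) D' ++ true :: false :: drop (size u) D'), e.
by apply: contr_farl; rewrite ?cat_take_drop ?size_takel //; lia.
Qed.

(** * Paths in a graph with coloured edges *)

Section Paths.
Variables (X : eqType) (nbr : nat -> X -> seq X).

(** A path is recorded without its starting point [x], so its length is that of the word of colours
    [w]. *)
Fixpoint paths (x : X) (w : seq nat) : seq (seq X) :=
  if w is c :: w' then [seq y :: p | y <- nbr c x, p <- paths y w']
  else [:: [::]].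

Fixpoint is_path (x : X) (w : seq nat) (p : seq X) : bool :=
  match w, p with
  | [::], [::] => true
  | c :: w', y :: p' => (y \in nbr c x) && is_path y w' p'
  | _, _ => false
  end.

Lemma mem_paths x w p : (p \in paths x w) = is_path x w p.
Proof.
elim: w x p => [|c w IH] x [|y p] //=.
  by apply/negP => /allpairsPdep[? [? []]].
apply/allpairsPdep/andP => [[z [q [yz qw [-> ->]]]]|[yn /= pw]].
  by rewrite -IH.
by exists y, p; rewrite IH.
Qed.

Lemma is_path_size x w p : is_path x w p -> size p = size w.
Proof. by elim: w x p => [|c w IH] x [|y p] //= /andP[_ /IH->]. Qed.

Lemma is_path_cat x w1 w2 p1 p2 : size p1 = size w1 ->
  is_path x (w1 ++ w2) (p1 ++ p2) =
    is_path x w1 p1 && is_path (last x p1) w2 p2.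
Proof.
by elim: w1 x p1 => [|c w IH] x [|y p] //= [/IH->]; rewrite andbA.
Qed.

Lemma paths_uniq x w : (forall c y, uniq (nbr c y)) -> uniq (paths x w).
Proof.
move=> un; elim: w x => //= c w IH x.
by apply: allpairs_uniq_dep => //= -[y p] [z q] _ _ [-> ->].
Qed.

Lemma big_paths_rcons (R : Type) (idx : R) (op : Monoid.law idx) x w c f :
  \big[op/idx]_(p <- paths x (rcons w c)) f p =
  \big[op/idx]_(p <- paths x w)
    \big[op/idx]_(y <- nbr c (last x p)) f (rcons p y).
Proof.
elim: w x f => [|d w IH] x f.
  by rewrite big_seq1 big_flatten big_map; under eq_bigr do rewrite big_seq1.
rewrite /= !(big_allpairs_dep (h := fun y p => y :: p)).
by apply: eq_bigr => y _; rewrite IH.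
Qed.

Hypothesis nbr_sym : forall c x y, y \in nbr c x -> x \in nbr c y.

Lemma is_path_rev x w p :
  is_path x w p -> is_path (last x p) (rev w) (rev (belast x p)).
Proof.
elim: w x p => [|c w IH] x [|y p] //= /andP[yx pw].
rewrite !rev_cons -!cats1 is_path_cat ?IH //=; last first.
  by rewrite !size_rev size_belast (is_path_size pw).
rewrite andbT; case: p pw => [|z p] _ /=; first exact: nbr_sym.
by rewrite rev_cons last_rcons nbr_sym.
Qed.

End Paths.

(** Labellings are paths for an adjacency that ignores the current vertex, which makes the lemmas on
    paths available; the start [0] is arbitrary. *)
Definition labellings L := @paths nat (fun c _ => L c) 0%N.

(** * Contraction of adjacent points *)

Lemma split_cat (T : Type) k (s : seq T) : (k <= size s)%N ->
  exists u v, s = u ++ v /\ size u = k.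
Proof. by move=> le_k; exists (take k s), (drop k s);
  rewrite cat_take_drop size_takel. Qed.

Definition is_labelling (L : nat -> seq nat) (w b : seq nat) : bool :=
  all2 (fun c x => x \in L c) w b.

Lemma is_labellingE L x w b :
  is_path (fun c _ => L c) x w b = is_labelling L w b.
Proof. by elim: w b x => [|c w IH] [|y b] x //=; rewrite IH. Qed.

Lemma is_labelling_size L w b : is_labelling L w b -> size b = size w.
Proof. by rewrite -(is_labellingE L 0%N) => /is_path_size. Qed.

Lemma is_labelling_cat L w1 w2 b1 b2 : size b1 = size w1 ->
  is_labelling L (w1 ++ w2) (b1 ++ b2) =
    is_labelling L w1 b1 && is_labelling L w2 b2.
Proof. by move=> E; rewrite -!(is_labellingE L 0%N) is_path_cat // !is_labellingE. Qed.

Lemma is_labelling_rev L w b :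
  is_labelling L (rev w) (rev b) = is_labelling L w b.
Proof.
elim: w b => [|c w IH] [|y b] //=; rewrite ?rev_cons.
- by case: rev.
- by case: rev.
apply/idP/idP.
  move=> H; have := is_labelling_size H; rewrite !size_rcons !size_rev => -[Es].
  move: H; rewrite -!cats1 is_labelling_cat ?size_rev // IH /= andbT.
  by rewrite /is_labelling /= andbC.
move=> /andP[yc wb];
  rewrite -!cats1 is_labelling_cat ?size_rev ?(is_labelling_size wb) //.
by rewrite IH wb /= andbT.
Qed.

Lemma sum_pick (T : eqType) (r : seq T) y (f : T -> nat) : uniq r -> y \in r ->
  (\sum_(b <- r) (b == y) * f b = f y)%N.
Proof.
move=> ur yr; rewrite (bigD1_seq y) //= eqxx mul1n big1 ?addn0 //.
by move=> b /negbTE->.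
Qed.

(** If a loop is closed its label is free, which gives [size (L c)] equal terms. Otherwise the label
    is forced by the other end of a string; that end has colour [c] because [D] respects the
    colours, so its label occurs once in [L c]. *)
Lemma contr_tev L i D D' e wu c wv bu bv : contr i D D' e ->
  size wu = i -> tev [::] D (wu ++ c :: c :: wv) -> uniq (L c) ->
  is_labelling L wu bu -> is_labelling L wv bv ->
  (\sum_(b <- L c) tev [::] D (bu ++ b :: b :: bv) =
     (if e then size (L c) else 1) * tev [::] D' (bu ++ bv))%N.
Proof.
move=> cD swu tw uL.
elim: cD wu wv bu bv swu tw => [u v|u z v|u z v|{}i u v u' v' {}e _ IH lt_iu su'
  |{}i u v u' v' {}e _ IH le_ui su'] wu wv bu bv swu tw lu lv.
- under eq_bigr do rewrite tev_ins ?(is_labelling_size lu) // eqxx.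
  by rewrite big_const_seq count_predT iter_addn_0 mulnC.
- have := tev_size tw; rewrite !size_cat /= swu.
  case: wv tw lv => [|d wv] tw lv /= sz; first by exfalso; lia.
  move: tw;
    rewrite -(cat_rcons z u) -(cat_rcons c wu) tev_ins ?size_rcons ?swu // =>
      /andP[/eqP dc _].
  case: bv lv => // y bv /= /andP[yc _]; rewrite dc in yc.
  under eq_bigr => b _.
    rewrite -(cat_rcons b bu) tev_ins ?size_rcons ?(is_labelling_size lu) ?swu //.
    rewrite eq_sym -mulnb cat_rcons.
    over.
  by rewrite sum_pick // cat_rcons mul1n.
- case/lastP: wu swu tw lu => // wu d; rewrite size_rcons => -[swu].
  rewrite cat_rcons tev_ins // => /andP[/eqP <- _].
  case/lastP: bu => [/is_labelling_size|bu y]; first by rewrite size_rcons.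
  move=> lu; have sbu : size bu = size wu.
    by have := is_labelling_size lu; rewrite !size_rcons => -[].
  move: lu; rewrite -!cats1 is_labelling_cat //= => /andP[_] /andP[yc _].
  under eq_bigr => b _ do rewrite -catA tev_ins ?sbu // -mulnb.
  by rewrite sum_pick // mul1n -catA.
- have [|wv1 [d1 [d2 [wv2 [Ewv sw]]]]] := @split_pair _ (size u - i - 2)%N wv.
    by have := tev_size tw; rewrite !size_cat /= swu; lia.
  have [|bv1 [x [y [bv2 [Ebv sb]]]]] := @split_pair _ (size u - i - 2)%N bv.
    by rewrite (is_labelling_size lv) Ewv size_cat /= sw; lia.
  have sbu := is_labelling_size lu.
  rewrite {}Ewv in tw lv; rewrite {}Ebv in lv *.
  rewrite (_ : wu ++ _ = (wu ++ c :: c :: wv1) ++ d1 :: d2 :: wv2) in tw;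
    last by rewrite -catA.
  rewrite tev_ins in tw; last by rewrite size_cat /=; lia.
  move: tw lv => /andP[_]; rewrite -catA /= => tw.
  rewrite !is_labelling_cat ?sw ?sb //= => /andP[lv1] /and3P[_ _ lv2].
  have E b : tev [::] (u ++ [:: true, false & v])
    (bu ++ [:: b, b & bv1 ++ [:: x, y & bv2]]) =
     (y == x) && tev [::] (u ++ v) (bu ++ [:: b, b & bv1 ++ bv2]) :> bool.
    rewrite (_ : bu ++ _ = (bu ++ b :: b :: bv1) ++ x :: y :: bv2);
      last by rewrite -catA.
    by rewrite tev_ins -?catA // size_cat /=; lia.
  under eq_bigr => b _ do rewrite E -mulnb.
  rewrite -big_distrr /= (IH _ _ _ _ swu tw lu) ?is_labelling_cat ?sw ?sb ?lv1 //.
  rewrite (catA bu bv1 (_ :: _)) tev_ins ?size_cat; last by lia.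
  by rewrite -catA -mulnb mulnCA.
- have [|wu1 [d1 [d2 [wu2 [Ewu sw]]]]] := @split_pair _ (size u)%N wu.
    by lia.
  have sbu := is_labelling_size lu.
  have [|bu1 [x [y [bu2 [Ebu sb]]]]] := @split_pair _ (size u)%N bu.
    by lia.
  rewrite {}Ewu in swu tw lu sbu; rewrite {}Ebu in lu sbu *.
  rewrite -catA /= tev_ins // in tw.
  move: swu sbu; rewrite !size_cat /= => swu sbu.
  move: tw lu => /andP[_ tw].
  rewrite !is_labelling_cat ?sw ?sb //= => /andP[lu1] /and3P[_ _ lu2].
  under eq_bigr => b _ do rewrite -catA /= tev_ins // -mulnb catA.
  rewrite -big_distrr /= (IH (wu1 ++ wu2) wv); first last.
  + by [].
  + by rewrite is_labelling_cat ?sw ?sb ?lu1.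
  + by rewrite -catA.
  + by rewrite size_cat; lia.
  rewrite -!(catA bu1) /= tev_ins ?su' // -mulnb.
  by rewrite mulnCA.
Qed.

(** * State sums over regions *)

Section Model.
Variables (X : eqType) (F : fieldType) (nbr : nat -> X -> seq X) (mu : X -> F).
Variable a : nat -> F.
Hypothesis nbr_sym : forall c x y, y \in nbr c x -> x \in nbr c y.
Hypothesis nbr_uniq : forall c x, uniq (nbr c x).
Hypothesis mu_neq0 : forall c x y, y \in nbr c x -> mu y != 0.
Hypothesis mu_sum : forall c x, mu x != 0 ->
  \sum_(y <- nbr c x) (mu y / mu x) ^+ 2 = a c.

(* [x] is the leftmost region and [p] lists the regions met after each point;
   [st] holds the (outer, inner) regions of the arcs opened before [D]. *)
Fixpoint fev (st : seq (X * X)) (D : seq bool) (x : X) (p : seq X) : F :=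
  match D, p with
  | [::], [::] => (nilp st)%:R
  | true :: D', y :: p' => fev ((x, y) :: st) D' y p'
  | false :: D', y :: p' =>
      if st is (o, i) :: st'
      then ((x == i) && (y == o))%:R * (mu i / mu o) * fev st' D' y p' else 0
  | _, _ => 0
  end.

Lemma fev_ins st u v x pu y z pv : size pu = size u ->
  fev st (u ++ true :: false :: v) x (pu ++ y :: z :: pv) =
  (z == last x pu)%:R * (mu y / mu (last x pu)) *
    fev st (u ++ v) x (pu ++ pv).
Proof.
elim: u st x pu => [|b u IH] st x [|h pu] //=.
  by rewrite eqxx; case: eqP => [->|] //; rewrite !mul0r.
case: b => -[E]; first by rewrite IH.
case: st => [|[o i] st]; first by rewrite mulr0.
by rewrite IH // mulrCA.
Qed.

Lemma fsum_pick (r : seq X) y (f : X -> F) : uniq r -> y \in r ->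
  \sum_(b <- r) (b == y)%:R * f b = f y.
Proof.
move=> ur yr; rewrite (bigD1_seq y) //= eqxx mul1r big1 ?addr0 //.
by move=> b /negbTE->; rewrite mul0r.
Qed.

(** The sum is over the region [y] between the two joined points. For a loop the factors form the
    sum of squares of [mu_sum]; for a zigzag the region is forced, and the prefactor cancels the
    factor of the removed arc. *)
Lemma contr_fev i D D' e x wu c wv pu pv : contr i D D' e ->
  size wu = i -> tev [::] D (wu ++ c :: c :: wv) ->
  is_path nbr x wu pu -> is_path nbr (last x pu) wv pv -> mu (last x pu) != 0 ->
  \sum_(y <- nbr c (last x pu)) mu y / mu (last x pu) *
      fev [::] D x (pu ++ y :: last x pu :: pv) =
  (if e then a c else 1) * fev [::] D' x (pu ++ pv).
Proof.
move=> cD swu tw.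
elim: cD x wu wv pu pv swu tw => [u v|u z v|u z v|{}i u v u' v' {}e _ IH lt_iu su'
  |{}i u v u' v' {}e _ IH le_ui su'] x wu wv pu pv swu tw lu lv mu0.
- rewrite -(mu_sum c mu0) mulr_suml; apply: eq_bigr => y _.
  by rewrite fev_ins ?(is_path_size lu) // eqxx mul1r mulrA.
- have := tev_size tw; rewrite !size_cat /= swu.
  case: wv tw lv => [|d wv] tw lv /= sz; first by exfalso; lia.
  move: tw;
    rewrite -(cat_rcons z u) -(cat_rcons c wu) tev_ins ?size_rcons ?swu // =>
      /andP[/eqP dc _].
  case: pv lv => // y pv /= /andP[yc _]; rewrite dc in yc.
  under eq_bigr => b _.
    rewrite -(cat_rcons b pu) fev_ins ?size_rcons ?(is_path_size lu) ?swu //.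
    rewrite last_rcons eq_sym cat_rcons -[_ * _ * fev _ _ _ _]mulrA mulrCA.
    over.
  rewrite fsum_pick // cat_rcons mul1r mulrA mulrA mulfVK ?mulfV ?mul1r //.
  exact: mu_neq0 yc.
- case/lastP: wu swu tw lu => // wu d; rewrite size_rcons => -[swu].
  rewrite cat_rcons tev_ins // => /andP[/eqP <- _].
  case/lastP: pu mu0 lv => [_ _ /is_path_size|pu y]; first by rewrite size_rcons.
  rewrite last_rcons => mu0 lv lu; have sbu : size pu = size wu.
    by have := is_path_size lu; rewrite !size_rcons => -[].
  move: lu; rewrite -!cats1 is_path_cat //= => /andP[_] /andP[/nbr_sym yc _].
  under eq_bigr => b _ do rewrite -catA fev_ins ?sbu
    // -[_ * _ * fev _ _ _ _]mulrA mulrCA.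
  rewrite fsum_pick // mul1r -catA mulrA mulrA mulfVK ?mulfV ?mul1r //.
  exact: mu_neq0 yc.
- have [|wv1 [d1 [d2 [wv2 [Ewv sw]]]]] := @split_pair _ (size u - i - 2)%N wv.
    by have := tev_size tw; rewrite !size_cat /= swu; lia.
  have [|bv1 [h [y [bv2 [Ebv sb]]]]] := @split_pair _ (size u - i - 2)%N pv.
    by rewrite (is_path_size lv) Ewv size_cat /= sw; lia.
  have sbu := is_path_size lu.
  rewrite {}Ewv in tw lv; rewrite {}Ebv in lv *.
  rewrite (_ : wu ++ _ = (wu ++ c :: c :: wv1) ++ d1 :: d2 :: wv2) in tw;
    last by rewrite -catA.
  rewrite tev_ins in tw; last by rewrite size_cat /=; lia.
  move: tw lv => /andP[_]; rewrite -catA /= => tw.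
  rewrite is_path_cat ?sw ?sb //= => /andP[lv1] /and3P[_ _ lv2].
  have E b : fev [::] (u ++ [:: true, false & v]) x
    (pu ++ [:: b, last x pu & bv1 ++ [:: h, y & bv2]]) =
     (y == last x (pu ++ bv1))%:R * (mu h / mu (last x (pu ++ bv1))) *
     fev [::] (u ++ v) x (pu ++ [:: b, last x pu & bv1 ++ bv2]).
    rewrite (_ : pu ++ _ = (pu ++ b :: last x pu :: bv1) ++ h :: y :: bv2);
      last by rewrite -catA.
    rewrite fev_ins -?catA; last by rewrite size_cat /=; lia.
    by rewrite !last_cat.
  under eq_bigr => b _ do rewrite E mulrCA.
  rewrite -big_distrr /= (catA pu bv1 (_ :: _)) fev_ins ?size_cat; last by lia.
  rewrite -catA [RHS]mulrCA; case: eqP lv2 => [->|_ _]; last by rewrite !mul0r.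
  rewrite last_cat => lv2; congr (_ * _).
  by apply: (IH _ _ _ _ _ swu tw lu); rewrite ?is_path_cat ?sw ?sb ?lv1.
- have [|wu1 [d1 [d2 [wu2 [Ewu sw]]]]] := @split_pair _ (size u)%N wu.
    by lia.
  have sbu := is_path_size lu.
  have [|pu1 [h [y [pu2 [Ebu sb]]]]] := @split_pair _ (size u)%N pu.
    by lia.
  rewrite {}Ewu in swu tw lu sbu; rewrite {}Ebu in lu lv mu0 sbu *.
  rewrite -catA /= tev_ins // in tw.
  move: swu sbu; rewrite !size_cat /= => swu sbu.
  move: tw lu => /andP[_ tw].
  rewrite is_path_cat ?sw ?sb //= => /andP[lu1] /and3P[_ _ lu2].
  under eq_bigr => b _ do rewrite -catA /= fev_ins // mulrCA catA.
  rewrite -big_distrr /= -catA /= fev_ins ?su' // [RHS]mulrCA.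
  move: lv mu0 lu2; rewrite !last_cat /=.
  case: (y =P last x pu1) => [->|_ _ _ _]; last by rewrite !mul0r.
  move=> lv mu0 lu2; congr (_ * _); rewrite catA -last_cat;
    apply: (IH x (wu1 ++ wu2) wv).
  + by rewrite size_cat; lia.
  + by rewrite -catA.
  + by rewrite is_path_cat ?sw ?sb // lu1.
  + by rewrite last_cat.
  + by rewrite last_cat.
Qed.

End Model.

(** * Composition by repeated contraction *)

Section Composition.
Variables (X : eqType) (F : fieldType) (nbr : nat -> X -> seq X) (mu : X -> F).
Variable a : nat -> F.
Hypothesis nbr_sym : forall c x y, y \in nbr c x -> x \in nbr c y.
Hypothesis nbr_uniq : forall c x, uniq (nbr c x).
Hypothesis mu_neq0 : forall c x y, y \in nbr c x -> mu y != 0.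
Hypothesis mu_sum : forall c x, mu x != 0 ->
  \sum_(y <- nbr c x) (mu y / mu x) ^+ 2 = a c.

Lemma mu_last x w p : is_path nbr x w p -> mu x != 0 -> mu (last x p) != 0.
Proof.
elim: w x p => [|c w IH] x [|y p] //= /andP[/mu_neq0 yx pw] _.
exact: IH pw yx.
Qed.

(** All arcs of [D1] are closed at its end, so a nonzero value requires the region met there to be
    the initial one again. *)
Lemma fev_cat D1 D2 x p1 p2 : dyck D1 -> size p1 = size D1 ->
  fev mu [::] (D1 ++ D2) x (p1 ++ p2) =
  (last x p1 == x)%:R * fev mu [::] D1 x p1 * fev mu [::] D2 x p2.
Proof.
move=> dD; elim: dD p1 => [|u v _ IH] p1.
  by case: p1 => //= _; rewrite eqxx !mul1r.
rewrite size_cat /= => Ep.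
have [|pu [y [z [pv [Ep1 Eu]]]]] := @split_pair _ (size u) p1; first by lia.
rewrite {}Ep1 in Ep *; rewrite -!catA /= !fev_ins // !catA IH; last first.
  by move: Ep; rewrite !size_cat /=; lia.
rewrite !last_cat /=; case: (z =P last x pu) => [->|_]; last by rewrite !(mul0r, mulr0).
ring.
Qed.

(* Stacking is iterated contraction: the sums run over the labels, resp. the
   regions, along the common edge [t]. *)
Lemma contr_many t D s r : tev [::] D (s ++ t ++ rev t ++ r) ->
  exists D' es, [/\ tev [::] D' (s ++ r), {subset es <= t},
    forall L bs br, (forall c, uniq (L c)) ->
      is_labelling L s bs -> is_labelling L r br ->
      (\sum_(b <- labellings L t) tev [::] D (bs ++ b ++ rev b ++ br) =
       \prod_(c <- es) size (L c) * tev [::] D' (bs ++ br))%N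
  & forall x ps pr, is_path nbr x s ps -> is_path nbr (last x ps) r pr ->
      mu (last x ps) != 0 ->
      \sum_(q <- paths nbr (last x ps) t)
        mu (last (last x ps) q) / mu (last x ps) *
        fev mu [::] D x (ps ++ q ++ rev (belast (last x ps) q) ++ pr) =
      \prod_(c <- es) a c * fev mu [::] D' x (ps ++ pr)].
Proof.
(* The innermost pair, the last letter of [t] and its mirror image, is joined first. *)
elim/last_ind: t D => [|t c IH] D.
  move=> tD; exists D, [::]; split=> // [L bs br _ _ _|x ps pr _ _ mu0].
    by rewrite /labellings /= big_seq1 big_nil mul1n.
  by rewrite /= big_seq1 big_nil divff.
rewrite rev_rcons -cats1 -!catA /= => tD.
have sD := tev_size tD.
have [|D1 [e cD]] := @contr_ex (size (s ++ t)) D (tev_dyck tD).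
  by rewrite sD !size_cat /=; lia.
rewrite catA in tD.
(* That [D1] still respects the colours is [contr_tev] with the colours themselves as labels, each
   set [L c] being reduced to [c]. *)
have tD1 : tev [::] D1 (s ++ t ++ rev t ++ r).
  have H w : is_labelling (fun c => [:: c]) w w.
    by elim: w => //= d w ->; rewrite inE eqxx.
  have := contr_tev cD (erefl _) tD (isT : uniq [:: c]) (H _) (H _).
  rewrite big_seq1 tD -catA; case: e {cD} => /= /esym/eqP; rewrite ?mul1n eqb1 //.
have [D' [es [tD' sub Tid fid]]] := IH D1 tD1.
exists D', (if e then c :: es else es); split=> //.
- move=> d; rewrite mem_cat inE orbC; case: e {cD} => [|/sub->]; rewrite ?orbT //.
  by rewrite inE => /orP[/eqP->|/sub->]; rewrite ?eqxx ?orbT.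
- move=> L bs br uL lbs lbr.
  rewrite /labellings cats1 big_paths_rcons.
  rewrite big_seq (eq_bigr (fun b => (if e then size (L c) else 1) *
     tev [::] D1 (bs ++ b ++ rev b ++ br)))%N; last first.
    move=> b; rewrite mem_paths is_labellingE => lb.
    have := contr_tev cD (erefl _) tD (uL c) (bu := bs ++ b) (bv := rev b ++ br).
    rewrite !is_labelling_cat ?size_rev ?(is_labelling_size lb)
      ?(is_labelling_size lbs) //.
    rewrite is_labelling_rev lbs lb lbr -catA => <- //.
    by apply: eq_bigr => y _; rewrite rev_rcons cat_rcons -catA.
  rewrite -big_seq -big_distrr /= Tid // mulnA; congr (_ * _)%N.
  by case: (e); rewrite ?big_cons ?mul1n.
- move=> x ps pr lps lpr mu0.
  rewrite cats1 big_paths_rcons.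
  (* The prefactor telescopes: its ratio for the longer path is its ratio for [q] times the one that
     [contr_fev] consumes. *)
  rewrite big_seq (eq_bigr (fun q => (if e then a c else 1) *
     (mu (last (last x ps) q) / mu (last x ps) *
     fev mu [::] D1 x (ps ++ q ++ rev (belast (last x ps) q) ++ pr)))); last first.
    move=> q; rewrite mem_paths => lq.
    have muA := mu_last lq mu0.
    have := contr_fev nbr_sym nbr_uniq mu_neq0 mu_sum cD (erefl _) tD
      (x := x) (pu := ps ++ q) (pv := rev (belast (last x ps) q) ++ pr).
    rewrite last_cat !is_path_cat ?size_rev ?size_belast ?(is_path_size lps)
      ?(is_path_size lq) //.
    rewrite lps lq is_path_rev //= (_ : last _ (rev _) = last x ps); last first.
      case: q {lq muA} => //= y q; rewrite rev_cons last_rcons //.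
    move=> /(_ isT lpr muA) H; rewrite mulrCA (catA ps q) -H.
    rewrite mulr_sumr; apply: eq_bigr => y _.
    rewrite last_rcons belast_rcons lastI rev_rcons -!catA cat_rcons.
    rewrite mulrA; congr (_ * _); field; rewrite mu0 muA //.
  rewrite -big_seq -mulr_sumr fid // mulrA; congr (_ * _).
  by case: (e); rewrite ?big_cons ?mul1r.
Qed.

End Composition.

(** * Dyck words of diagrams *)

Section Matchings.
Variables (P : eqType) (pos : P -> nat).
Implicit Types (d : P -> P) (pts : seq P).

Definition ascending pts := pairwise (fun x y => pos x < pos y)%N pts.

Definition openings d pts := [seq (pos x < pos (d x))%N | x <- pts].

Definition is_matching d pts :=
  {in pts, forall x, [&& d x \in pts, d (d x) == x & d x != x]}.

Definition uncrossed d pts :=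
  {in pts &, forall x y,
    ~~ [&& pos x < pos y, pos y < pos (d x) & pos (d x) < pos (d y)]%N}.

Lemma ascending_adjacent u x y v : ascending (u ++ x :: y :: v) ->
  (pos x < pos y)%N /\
  {in u ++ v, forall z, (pos z < pos x)%N || (pos y < pos z)%N}.
Proof.
rewrite /ascending pairwise_cat /= => /and3P[/allrelP uxy _].
move=> /and3P[/andP[xy _] /allP yv _]; split=> // z.
rewrite mem_cat => /orP[zu|/yv->]; last by rewrite orbT.
by rewrite uxy ?inE ?eqxx.
Qed.

Lemma ascending_del u x y v : ascending (u ++ x :: y :: v) -> ascending (u ++ v).
Proof.
apply: subseq_pairwise; apply: cat_subseq => //.
by apply: subseq_trans (subseq_cons _ _); exact: subseq_cons.
Qed.

Lemma ascending_notin u x y v : ascending (u ++ x :: y :: v) ->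
  (x \notin u ++ v) && (y \notin u ++ v).
Proof.
move=> /ascending_adjacent[xy H]; apply/andP.
by split; apply/negP => /H; rewrite ltnn ?orbF /= ltnNge ltnW.
Qed.

Lemma ascending_inj pts : ascending pts -> {in pts &, injective pos}.
Proof.
move=> asc x y xp yp; case/splitPr: xp asc yp => u v.
rewrite /ascending pairwise_cat /= => /and3P[/allrelP uxv _ /andP[/allP xv _]].
rewrite mem_cat inE => /or3P[yu|/eqP->|yv] // E.
  by have := uxv y x yu; rewrite inE eqxx E ltnn => /(_ isT).
by have := xv _ yv; rewrite E ltnn.
Qed.

(* An arc of minimal span joins neighbours. *)
Lemma innermost_arc d pts : ascending pts -> is_matching d pts ->
  uncrossed d pts -> pts != [::] ->
  exists u x v, pts = u ++ x :: d x :: v /\ (pos x < pos (d x))%N.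
Proof.
move=> asc dm dn; case Ep: pts => [//|h t] _; rewrite -Ep.
have hp : h \in pts by rewrite Ep inE eqxx.
have [x0 x0p lt0] : exists2 x, x \in pts & (pos x < pos (d x))%N.
  exists h => //; have /and3P[] := dm h hp.
  rewrite {1}Ep inE => /orP[/eqP->|dh _ _]; first by rewrite eqxx.
  by move: asc; rewrite Ep /ascending /= => /andP[/allP/(_ _ dh)].
have [k] := ubnP (pos (d x0) - pos x0)%N.
elim: k => // k IH in x0 x0p lt0 *; rewrite ltnS => le_k.
have /and3P[dxp /eqP ddx dxn] := dm _ x0p.
case: (boolP (has (fun z => pos x0 < pos z < pos (d x0))%N pts)).
  move=> /hasP[z zp /andP[xz zd]].
  have /and3P[dzp /eqP ddz dzn] := dm _ zp.
  have pinj := ascending_inj asc.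
  have n1 : pos (d z) <> pos x0.
    by move=> /pinj -/(_ dzp x0p) E; move: zd; rewrite -E ddz ltnn.
  have n2 : pos (d z) <> pos (d x0).
    by move=> /pinj -/(_ dzp dxp) E; move: xz; rewrite -ddx -E ddz ltnn.
  have n3 : pos (d z) <> pos z.
    by move=> /pinj -/(_ dzp zp)/eqP; rewrite (negbTE dzn).
  (* The arc of [z] does not cross that of [x0], so it lies strictly inside and has a smaller
     span. *)
  have c1 := dn x0 z x0p zp; have c2 := dn (d z) x0 dzp x0p.
  rewrite ddz in c2.
  have [lt_z|le_z] := ltnP (pos z) (pos (d z)).
    by apply: (IH z zp lt_z); lia.
  by apply: (IH (d z) dzp); rewrite ?ddz; lia.
move=> /hasPn adj; case/splitPr: x0p asc dxp adj {IH le_k hp Ep dm dn} => u v asc.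
rewrite mem_cat inE (negbTE dxn) /= => dxp adj.
move: (asc);
  rewrite /ascending pairwise_cat /= => /and3P[/allrelP H _ /andP[/allP xv yv]].
have {}dxp : d x0 \in v.
  case/orP: dxp => // du; have := H _ x0 du; rewrite inE eqxx => /(_ isT).
  by rewrite ltnNge ltnW.
case: v xv yv dxp adj {H asc} => // y v xv /= /andP[/allP yv _].
rewrite inE => /predU1P[<- _|dv /(_ y)]; first by exists u, x0, v.
by rewrite mem_cat !inE eqxx !orbT xv ?inE ?eqxx // yv // => /(_ isT).
Qed.

Lemma matching_del d u x v : is_matching d (u ++ x :: d x :: v) ->
  ascending (u ++ x :: d x :: v) -> is_matching d (u ++ v).
Proof.
move=> dm asc z zp.
have /andP[nx ny] := ascending_notin asc.
have mem y : (y \in u ++ x :: d x :: v) = [|| y == x, y == d x | y \in u ++ v].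
  by rewrite !(mem_cat, inE); do !case: (_ \in _); rewrite ?orbT.
have /and3P[] : [&& d z \in u ++ x :: d x :: v, d (d z) == z & d z != z].
  by apply: dm; rewrite mem zp !orbT.
have /and3P[_ /eqP ddx _] : [&& d x \in u ++ x :: d x :: v, d (d x) == x & d x != x].
  by apply: dm; rewrite mem eqxx.
rewrite mem => /or3P[/eqP E|/eqP E|->] /eqP ddz -> //.
- by exfalso; move: ny; rewrite -E ddz zp.
- by exfalso; move: nx; rewrite -ddx -E ddz zp.
- by rewrite ddz eqxx.
Qed.

(** Induction on the number of points: an innermost arc is removed on the left by [tev_ins] and on
    the right by splitting [all]. *)
Lemma tev_openings d pts beta : ascending pts -> is_matching d pts ->
  uncrossed d pts ->
  tev [::] (openings d pts) (map beta pts) =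
    all (fun x => beta x == beta (d x)) pts.
Proof.
have [k] := ubnP (size pts); elim: k pts => // k IH pts; rewrite ltnS => le_k.
move=> asc dm dn; have [->//|pn] := eqVneq pts [::].
have [u [x [v [Ep lt]]]] := innermost_arc asc dm dn pn.
rewrite {}Ep {pn} in le_k asc dm dn *.
have /and3P[_ /eqP ddx _] : [&& d x \in u ++ x :: d x :: v, d (d x) == x & d x != x].
  by apply: dm; rewrite mem_cat inE eqxx orbT.
rewrite /openings !map_cat /= lt ddx ltnNge (ltnW lt) tev_ins ?size_map //.
rewrite -!map_cat IH.
- rewrite !all_cat /= ddx !(eq_sym (beta (d x))).
  by case: (beta x == _); rewrite ?andbF.
- by move: le_k; rewrite !size_cat /=; lia.
- exact: ascending_del asc.
- exact: matching_del asc.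
- move=> y z yp zp; apply: dn; rewrite !(mem_cat, inE).
    by move: yp; rewrite mem_cat => /orP[]->; rewrite ?orbT.
  by move: zp; rewrite mem_cat => /orP[]->; rewrite ?orbT.
Qed.

(** Each insertion of [dyck] adds an arc between neighbours, which crosses no other arc. *)
Lemma dyck_matching D pts : dyck D -> ascending pts -> size pts = size D ->
  exists d, [/\ is_matching d pts, uncrossed d pts & openings d pts = D].
Proof.
move=> dD; elim: dD pts => [|u v _ IH] pts asc.
  by case: pts asc => // _ _; exists id.
rewrite size_cat /= => sp.
have [|pu [x [y [pv [Ep su]]]]] := @split_pair _ (size u) pts; first by lia.
rewrite {}Ep in asc sp *.
have [|d0 [dm dn dD]] := IH _ (ascending_del asc).
  by move: sp; rewrite !size_cat /=; lia.
have /andP[nx ny] := ascending_notin asc.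
have [xy adj] := ascending_adjacent asc.
have nxy : x == y = false by apply/negbTE/eqP => E; rewrite E ltnn in xy.
have nyx : y == x = false by rewrite eq_sym.
pose d z := if z == x then y else if z == y then x else d0 z.
have dx : d x = y by rewrite /d eqxx.
have dy : d y = x by rewrite /d nyx eqxx.
have dE z : z \in pu ++ pv -> d z = d0 z.
  by rewrite /d => zp; case: eqP zp nx => [->->|_] //; case: eqP ny => [->|] // + zp;
    rewrite zp.
have mem z : (z \in pu ++ x :: y :: pv) = [|| z == x, z == y | z \in pu ++ pv].
  by rewrite !(mem_cat, inE); do !case: (_ \in _); rewrite ?orbT.
exists d; split.
- move=> z; rewrite mem => /or3P[/eqP->|/eqP->|zp].
  + by rewrite dx dy mem nyx !eqxx.
  + by rewrite dy dx mem nxy !eqxx.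
  have /and3P[dzp ddz dzn] := dm z zp.
  by rewrite dE // dE // mem dzp ddz dzn !orbT.
- move=> z t; rewrite !mem => /or3P[/eqP->|/eqP->|zp] /or3P[/eqP->|/eqP->|tp];
    rewrite ?dx ?dy ?(dE _ zp) ?(dE _ tp); try (by lia).
  + by have := adj t tp; lia.
  + by have /and3P[dzp _ _] := dm z zp; have := adj _ dzp; lia.
  + exact: dn.
- rewrite /openings map_cat /= dx dy xy ltnNge (ltnW xy) /=.
  move: dD; rewrite /openings map_cat => /eqP.
  rewrite eqseq_cat ?size_map // => /andP[/eqP<- /eqP<-].
  by congr (_ ++ _ :: _ :: _); apply/eq_in_map => z zp; rewrite dE // mem_cat zp ?orbT.
Qed.

End Matchings.

(** * Diagrams and their codes *)

Section Diagrams.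
Variables m n : nat.
Local Notation N := (m * n)%N.
Implicit Types d : diagram m n.

Definition word : seq nat := mkseq (color m) N.

Lemma word_enum : word = [seq color m (val i) | i <- enum 'I_N].
Proof. by rewrite /word /mkseq -val_enum_ord -map_comp. Qed.

(** The boundary points in clockwise order, that is by increasing [bpos]; the bottom edge is
    therefore read from right to left. *)
Definition bpts : seq (bpoint N) :=
  [seq inl i | i <- enum 'I_N] ++ rev [seq inr i | i <- enum 'I_N].

Lemma map_bpts (T : Type) (f : bpoint N -> T) :
  map f bpts =
    [seq f (inl i) | i <- enum 'I_N] ++ rev [seq f (inr i) | i <- enum 'I_N].
Proof. by rewrite map_cat map_rev -(map_comp f inl) -(map_comp f inr). Qed.

Lemma mem_bpts x : x \in bpts.
Proof.
by rewrite mem_cat mem_rev; case: x => i; apply/orP; [left|right];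
  apply: map_f; rewrite mem_enum.
Qed.

Lemma bpos_bpts : map (@bpos N) bpts = iota 0 (N + N).
Proof.
have E : map (@bpos N) [seq inr i | i <- enum 'I_N] =
    [seq (2 * N).-1 - k | k <- iota 0 N]%N.
  by rewrite -val_enum_ord -!map_comp.
rewrite map_cat map_rev E -map_comp iotaD add0n -{2}val_enum_ord.
congr (_ ++ _); apply: (@eq_from_nth _ 0%N) => [|i].
  by rewrite size_rev size_map !size_iota.
rewrite size_rev size_map !size_iota => lt_i.
rewrite nth_rev ?size_map ?size_iota // (nth_map 0%N) ?size_iota ?nth_iota //; lia.
Qed.

Lemma ascending_bpts : ascending (@bpos N) bpts.
Proof.
rewrite /ascending -(pairwise_map (@bpos N) ltn) bpos_bpts -sorted_pairwise.
  exact: iota_ltn_sorted.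
exact: ltn_trans.
Qed.

Definition code (d : {ffun bpoint N -> bpoint N}) := openings (@bpos N) d bpts.

Lemma bcolor_bpts : map (@bcolor m N) bpts = word ++ rev word.
Proof.
by rewrite map_bpts word_enum.
Qed.

Lemma diagram_matching d : is_matching d bpts.
Proof.
case: d => d /= /and3P[/forallP H _ _] x _; have /andP[-> ->] := H x.
by rewrite mem_bpts.
Qed.

Lemma diagramK d : involutive d.
Proof. by move=> x; have /and3P[_ /eqP] := diagram_matching d (mem_bpts x). Qed.

Lemma diagram_color d x : bcolor m (d x) = bcolor m x.
Proof. by case: d => d /= /and3P[_ _ /forallP/(_ x)/eqP]. Qed.

Lemma diagram_uncrossed d : uncrossed (@bpos N) d bpts.
Proof.
case: d => d /= /and3P[_ /existsPn H _] x y _ _.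
by have /existsPn/(_ y) := H x.
Qed.

Lemma codeP d beta :
  tev [::] (code d) (map beta bpts) = [forall x, beta x == beta (d x)].
Proof.
rewrite tev_openings; last exact: diagram_uncrossed.
- apply/allP/forallP => H x; first exact: H (mem_bpts x).
  by move=> _; exact: H.
- exact: ascending_bpts.
- exact: diagram_matching.
Qed.

Lemma code_color d : tev [::] (code d) (word ++ rev word).
Proof.
by rewrite -bcolor_bpts codeP; apply/forallP => x; rewrite diagram_color.
Qed.

Lemma code_ex D : tev [::] D (word ++ rev word) -> exists d : diagram m n, code d = D.
Proof.
move=> tD; have sD : size bpts = size D.
  by rewrite (tev_size tD) -bcolor_bpts size_map.
have [d [dm dn dD]] := dyck_matching (tev_dyck tD) ascending_bpts sD.
pose d' := [ffun x => d x].
have cD : code d' = D.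
  by rewrite -dD /code /openings; apply: eq_map => x; rewrite ffunE.
have dm' : is_matching d' bpts.
  by move=> x xp; rewrite !ffunE; exact: dm.
have dn' : uncrossed (@bpos N) d' bpts.
  by move=> x y xp yp; rewrite !ffunE; exact: dn.
suff H : [&& perfect_matching d', noncrossing d' & color_preserving m d'].
  by exists (Diagram H).
apply/and3P; split.
- apply/forallP => x; have /and3P[_ -> ->] := dm' _ (mem_bpts x); by [].
- apply/existsPn => x; apply/existsPn => y.
  exact: (dn' _ _ (mem_bpts x) (mem_bpts y)).
- move: tD; rewrite -bcolor_bpts -dD tev_openings //; last exact: ascending_bpts.
  by move/allP => H; apply/forallP => x; rewrite ffunE eq_sym H ?mem_bpts.
Qed.

Definition edge_labels (f : 'I_N -> nat) : seq nat := [seq f i | i <- enum 'I_N].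

Lemma edge_inj f g : edge_labels f = edge_labels g -> f =1 g.
Proof. by move/eq_in_map => H i; apply: H; rewrite mem_enum. Qed.

Definition glue (f g : 'I_N -> nat) (x : bpoint N) : nat :=
  match x with inl i => f i | inr i => g i end.

Lemma tev_code d f g : tev [::] (code d) (edge_labels f ++ rev (edge_labels g)) =
  [forall x, glue f g x == glue f g (d x)].
Proof. by rewrite -codeP map_bpts. Qed.

Lemma edge_ex s : size s = N -> exists f, s = edge_labels f.
Proof.
move=> ss; exists (fun i => nth 0%N s i); rewrite /edge_labels.
by rewrite -[LHS](mkseq_nth 0%N) ss /mkseq -val_enum_ord -map_comp.
Qed.

Lemma is_labelling_edge L f :
  is_labelling L word (edge_labels f) = [forall i : 'I_N, f i \in L (color m i)].
Proof.
rewrite word_enum /edge_labels /is_labelling.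
transitivity (all (fun i : 'I_N => f i \in L (color m i)) (enum 'I_N)).
  by elim: (enum _) => //= i s ->.
apply/allP/forallP => H i; first by apply: H; rewrite mem_enum.
by move=> _; exact: H.
Qed.

(** The indicator of the pair [x], [d2 x] is compatible with [d2]; being compatible with [d1] too,
    it forces [d1 x = d2 x]. Diagrams can thus be compared by counting labellings by [0] and [1]. *)
Lemma code_separated d1 d2 :
  (forall beta : bpoint N -> nat, (forall x, beta x \in [:: 0; 1]%N) ->
     tev [::] (code d1) (map beta bpts) = tev [::] (code d2) (map beta bpts)) ->
  d1 = d2.
Proof.
move=> E; apply: val_inj; apply/ffunP => x /=.
have := E (fun y => (y == x) || (y == d2 x) : nat); rewrite !codeP => H.
have : [forall y, ((y == x) || (y == d2 x)) == ((d2 y == x) || (d2 y == d2 x)) :> nat].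
  apply/forallP => y; rewrite (inj_eq (inv_inj (diagramK d2))).
  by rewrite (can2_eq (diagramK d2) (diagramK d2)) orbC.
rewrite -H => [/forallP/(_ x)|y]; last by case: (_ || _).
rewrite eqxx /= eq_sym eqb1 => /orP[|/eqP//].
have /and3P[_ _ /negbTE->] := diagram_matching d1 (mem_bpts x); by [].
Qed.

Lemma code_inj d1 d2 : code d1 = code d2 -> d1 = d2.
Proof. by move=> E; apply: code_separated => beta _; rewrite E. Qed.

End Diagrams.

(** * Stacking *)

Section Stacking.
Variables m n : nat.
Local Notation N := (m * n)%N.
Variables d1 d2 : diagram m n.
Implicit Types (d : diagram m n) (f g : 'I_N -> nat).

Lemma mid_top : (mid_row == top_row) = false.
Proof. by rewrite -val_eqE /= !inordK. Qed.

Lemma bot_top : (bot_row == top_row) = false.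
Proof. by rewrite -val_eqE /= !inordK. Qed.

Lemma bot_mid : (bot_row == mid_row) = false.
Proof. by rewrite -val_eqE /= !inordK. Qed.

Lemma strings_upper x : strings d1 d2 (upper x) (upper (d1 x)).
Proof. by apply/orP; left; apply/existsP; exists x; rewrite !eqxx. Qed.

Lemma strings_lower x : strings d1 d2 (lower x) (lower (d2 x)).
Proof. by apply/orP; right; apply/existsP; exists x; rewrite !eqxx. Qed.

Lemma strings_sym : symmetric (strings d1 d2).
Proof.
suff H u v : strings d1 d2 u v -> strings d1 d2 v u by move=> u v; apply/idP/idP;
  exact: H.
case/orP=> /existsP[x /andP[/eqP-> /eqP->]].
  by rewrite -{2}[x](diagramK d1) strings_upper.
by rewrite -{2}[x](diagramK d2) strings_lower.
Qed.

Local Notation joined := (connect (strings d1 d2)).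

Lemma joined_sym : connect_sym (strings d1 d2).
Proof. exact: sym_connect_sym strings_sym. Qed.

Lemma joined_const (T : Type) (h : spoint m n -> T) :
  (forall x, h (upper x) = h (upper (d1 x))) ->
  (forall x, h (lower x) = h (lower (d2 x))) ->
  forall u v, joined u v -> h u = h v.
Proof.
move=> hu hl u v /connectP[p + ->]; elim: p u => //= w p IH u /andP[uw /IH <-].
by case/orP: uw => /existsP[x /andP[/eqP-> /eqP->]].
Qed.

Definition tri_label f g h (u : spoint m n) : nat :=
  if u.1 == top_row then f u.2 else if u.1 == mid_row then g u.2 else h u.2.

Lemma tri_upper f g h x : tri_label f g h (upper x) = glue f g x.
Proof. by case: x => i; rewrite /tri_label /= ?mid_top ?eqxx. Qed.

Lemma tri_lower f g h x : tri_label f g h (lower x) = glue g h x.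
Proof. by case: x => i; rewrite /tri_label /= ?mid_top ?bot_top ?bot_mid ?eqxx. Qed.

Lemma tri_outer f g h x : tri_label f g h (outer x) = glue f h x.
Proof. by case: x => i; rewrite /tri_label /= ?mid_top ?bot_top ?bot_mid ?eqxx. Qed.

Lemma tri_mid f g h i : tri_label f g h (mid_row, i) = g i.
Proof. by rewrite /tri_label /= mid_top eqxx. Qed.

Let zero (i : 'I_N) := 0%N.

Definition agree d f g := tev [::] (code d) (edge_labels f ++ rev (edge_labels g)).

Lemma agreeP d f g :
  reflect (forall x, glue f g x = glue f g (d x)) (agree d f g).
Proof.
by rewrite /agree tev_code; apply: (iffP forallP) => H x; apply/eqP; rewrite H.
Qed.

Lemma joined_tri f g h : agree d1 f g -> agree d2 g h ->
  forall u v, joined u v -> tri_label f g h u = tri_label f g h v.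
Proof.
move=> /agreeP H1 /agreeP H2; apply: joined_const => x.
  by rewrite !tri_upper.
by rewrite !tri_lower.
Qed.

Let component (i : 'I_N) := [set i' | joined (mid_row, i) (mid_row, i')].

Lemma component_eq i i' : i' \in component i -> component i' = component i.
Proof.
rewrite inE => ii'; apply/setP => k; rewrite !inE.
by rewrite (same_connect joined_sym ii').
Qed.

Lemma loopsP (j : 'I_m) (B : {set 'I_N}) :
  reflect (exists2 i, on_loop d1 d2 i && (color m i == j) & B = component i)
    (B \in loops d1 d2 j).
Proof.
apply: (iffP imsetP) => -[k]; last by exists k; rewrite ?inE.
by rewrite inE; exists k.
Qed.

Lemma joined_color u v : joined u v -> color m u.2 = color m v.2.
Proof.
move=> uv.
apply: (joined_const (h := fun w : spoint m n => color m w.2)) uv => x.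
  by have := diagram_color d1 x; case: (d1 x) => ?; case: x => ? /=.
by have := diagram_color d2 x; case: (d2 x) => ?; case: x => ? /=.
Qed.

(* Binary labels of colour [j] compatible with the strings and vanishing on
   the outer edges are the unions of loops of colour [j]. *)
Lemma card_loops (j : 'I_m) (L := fun c : nat => if c == j then [:: 0;
  1]%N else [:: 0%N]) :
  (\sum_(b <- labellings L (rev (word m n)))
     (tev [::] (code d1) (edge_labels zero ++ b) &&
      tev [::] (code d2) (rev b ++ rev (edge_labels zero))) =
   2 ^ #|loops d1 d2 j|)%N.
Proof.
pose P b := tev [::] (code d1) (edge_labels zero ++ b) &&
  tev [::] (code d2) (rev b ++ rev (edge_labels zero)).
rewrite -[LHS]/(\sum_(b <- labellings L (rev (word m n)))
  (P b : nat))%N -big_mkcond /= sum1_count -size_filter -card_powerset cardE.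
(* A set of loops is sent to the indicator of the points that it covers; this will be a bijection
   onto the compatible labellings. *)
pose lab (Q : {set {set 'I_N}}) := rev (edge_labels (fun i : 'I_N =>
  i \in cover Q : nat)).
rewrite -(size_map lab); apply: perm_size; apply: uniq_perm.
- by apply/filter_uniq/paths_uniq => c _; rewrite /L; case: eqP.
- rewrite map_inj_in_uniq ?enum_uniq // => Q Q'.
  rewrite !mem_enum !powersetE => QL QL' /(can_inj revK) E.
  have {}E : cover Q = cover Q'.
    by apply/setP => i; have := edge_inj E i; do 2!case: (_ \in _).
  (* Two loops with a common point are equal, so a set of loops is determined by its cover. *)
  have sub (Q1 Q2 : {set {set 'I_N}}) : Q1 \subset loops d1 d2 j ->
      Q2 \subset loops d1 d2 j -> cover Q1 = cover Q2 -> Q1 \subset Q2.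
    move=> /subsetP s1 /subsetP s2 E12; apply/subsetP => B BQ.
    have /loopsP[i _ EB] := s1 _ BQ.
    have iB : i \in B by rewrite EB inE connect0.
    have : i \in cover Q2 by rewrite -E12; apply/bigcupP; exists B.
    case/bigcupP => B' B'Q; have /loopsP[i' _ EB'] := s2 _ B'Q.
    by rewrite EB' => /component_eq E'; rewrite EB E' -EB'.
  by apply/eqP; rewrite eqEsubset; apply/andP; split; exact: sub.
move=> b; rewrite mem_filter mem_paths is_labellingE.
apply/andP/mapP => [[/andP[]]|[Q]].
  move=> tb1 tb2 lb; have sb := is_labelling_size lb.
  have [|f Ef] := @edge_ex m n (rev b);
    first by rewrite size_rev sb size_rev size_mkseq.
  have Eb : b = rev (edge_labels f) by rewrite -Ef revK.
  rewrite {}Eb in tb1 tb2 lb *; rewrite revK in tb2.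
  rewrite is_labelling_rev is_labelling_edge in lb; move/forallP in lb.
  have cst := joined_tri tb1 tb2.
  have f01 i : f i = (f i == 1%N) :> nat.
    have := lb i; rewrite /L; case: ifP => _; rewrite !inE; first case/orP;
      by move/eqP->.
  pose Q := [set B in loops d1 d2 j | B \subset [set i | f i == 1%N]].
  exists Q; first by rewrite mem_enum powersetE; apply/subsetP => B;
    rewrite inE => /andP[].
  rewrite /lab; congr (rev _); apply: eq_map => i; rewrite f01; congr (nat_of_bool _).
  apply/idP/bigcupP => [fi|[B]]; last first.
    by rewrite inE => /andP[_ /subsetP sB] /sB; rewrite inE.
  exists (component i); last by rewrite inE connect0.
  rewrite inE; apply/andP; split; last first.
    apply/subsetP => k; rewrite !inE => /cst; rewrite !tri_mid => <-; exact: fi.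
  apply/loopsP; exists i => //; apply/andP; split.
    apply/existsPn => x; apply/negP => /cst; rewrite tri_mid tri_outer.
    by case: x => ? /=; rewrite (eqP fi).
  by have := lb i; rewrite /L; case: ifP => //; rewrite inE (eqP fi).
rewrite mem_enum powersetE => /subsetP QL ->.
have inQ i : i \in cover Q -> on_loop d1 d2 i && (color m i == j).
  case/bigcupP => B /QL/loopsP[k /andP[ok ck] ->]; rewrite inE => ki.
  rewrite -(joined_color ki) ck andbT; apply/existsPn => x; apply/negP => ix.
  by have /existsPn/(_ x)/negP := ok; apply; exact: connect_trans ki ix.
have closed i k : i \in cover Q -> joined (mid_row, i) (mid_row, k) -> k \in cover Q.
  case/bigcupP => B BQ; have /loopsP[l _ EB] := QL _ BQ.
  rewrite EB inE => li ik; apply/bigcupP; exists B => //.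
  by rewrite EB inE; exact: connect_trans li ik.
(* The indicator of the chosen loops, extended by zero to the outer edges; it is constant along the
   strings because no loop reaches these edges. *)
pose h (u : spoint m n) := (u.1 == mid_row) && (u.2 \in cover Q).
have hE u : h u = tri_label zero (fun i => i \in cover Q) zero u :> nat.
  rewrite /h /tri_label; case: u => r i /=.
  by case: (r =P top_row) => [->|_]; [rewrite eq_sym mid_top|case: eqP].
have hc u v : joined u v -> h u -> h v.
  case: u v => [r i] [r' k] uv /andP[/= /eqP Er iQ]; rewrite Er in uv.
  have /andP[/existsPn io _] := inQ i iQ.
  rewrite /h /=; case: (r' =P mid_row) uv => [-> /=|nr]; first exact: closed.
  move=> uv; have [Er'|nr'] := eqVneq r' top_row.
    by have := io (inl k); rewrite /= -Er' uv.
  suff Er' : r' = bot_row by have := io (inr k); rewrite /= -Er' uv.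
  apply/val_inj => /=; rewrite inordK //; move/eqP: nr nr'.
  by rewrite -!val_eqE /= !inordK //; case: (r') => [[|[|[|]]]].
have {}hc u v : joined u v -> h u = h v.
  by move=> uv; apply/idP/idP; apply: hc; rewrite // joined_sym.
split; last first.
  rewrite is_labelling_rev is_labelling_edge; apply/forallP => i; rewrite /L.
  case: (boolP (i \in cover Q)) => [/inQ/andP[_ ->]|_];
    first by rewrite !inE eqxx ?orbT.
  by case: ifP.
rewrite /P revK; apply/andP; split; apply/agreeP => x.
  rewrite -!(tri_upper _ _ zero) -!hE; congr (nat_of_bool _).
  exact/hc/connect1/strings_upper.
rewrite -!(tri_lower zero) -!hE; congr (nat_of_bool _).
exact/hc/connect1/strings_lower.
Qed.

End Stacking.

(** * Products of diagrams by counting labellings *)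

Section Product.
Variables m n : nat.
Hypothesis m_gt0 : (0 < m)%N.
Local Notation N := (m * n)%N.
Local Notation word := (word m n).
Local Notation bpts := (bpts m n).
Implicit Types d : diagram m n.

Lemma color_lt k : (color m k < m)%N.
Proof.
rewrite /color; have := ltn_pmod k m_gt0; case: odd; lia.
Qed.

Lemma word_lt c : c \in word -> (c < m)%N.
Proof. by case/mapP => k _ ->; exact: color_lt. Qed.

(* [d] is the stacking of [d1] and [d2] and [es] lists the colours of the
   removed loops, as witnessed by counting compatible labellings. *)
Definition stacks d1 d2 d es := {subset es <= rev word} /\
  forall L bs br, (forall c, uniq (L c)) ->
    is_labelling L word bs -> is_labelling L (rev word) br ->
    (\sum_(b <- labellings L (rev word))
       (tev [::] (code d1) (bs ++ b) && tev [::] (code d2) (rev b ++ br)) =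
     \prod_(c <- es) size (L c) * tev [::] (code d) (bs ++ br))%N.

Let L01 := fun _ : nat => [:: 0; 1]%N.

Lemma labelling_bpts L (beta : bpoint N -> nat) :
  (forall x, beta x \in L (bcolor m x)) ->
  exists bs br, [/\ is_labelling L word bs, is_labelling L (rev word) br,
    map beta bpts = bs ++ br, bs = edge_labels (beta \o inl) & br = rev (edge_labels
      (beta \o inr))].
Proof.
move=> Lb; exists (edge_labels (beta \o inl)), (rev (edge_labels (beta \o inr))).
rewrite is_labelling_rev !is_labelling_edge map_bpts.
split=> //; apply/forallP => i; [exact: Lb (inl i)|exact: Lb (inr i)].
Qed.

Lemma labelling_edge L s : is_labelling L (rev word) s ->
  exists2 g : 'I_N -> nat, s = rev (edge_labels g) & forall i, g i \in L (color m i).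
Proof.
move=> ls; have [|g Eg] := @edge_ex m n (rev s).
  by rewrite size_rev (is_labelling_size ls) size_rev size_mkseq.
exists g; first by rewrite -Eg revK.
by move: ls; rewrite -{1}[s]revK Eg is_labelling_rev is_labelling_edge => /forallP.
Qed.

Lemma edge_labelling L (g : 'I_N -> nat) : (forall i, g i \in L (color m i)) ->
  is_labelling L word (edge_labels g) /\ is_labelling L (rev word) (rev
    (edge_labels g)).
Proof. by move=> Lg; rewrite is_labelling_rev is_labelling_edge; split;
  apply/forallP. Qed.

(** With both labels allowed for every colour, the factor of the loops is positive, so the count is
    nonzero exactly when [d] is compatible with the outer labels. *)
Lemma stacks_agree d1 d2 d es (f h : 'I_N -> nat) : stacks d1 d2 d es ->
  (forall i, f i \in [:: 0; 1]%N) -> (forall i, h i \in [:: 0; 1]%N) ->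
  agree d f h <-> exists g, [/\ forall i, g i \in [:: 0;
    1]%N, agree d1 f g & agree d2 g h].
Proof.
move=> [_ H] f01 h01.
have [lf _] := edge_labelling (L := L01) f01.
have [_ lh] := edge_labelling (L := L01) h01.
have {}H := H L01 _ _ (fun=> isT) lf lh.
have pos : (0 < \prod_(c <- es) size (L01 c))%N by rewrite prodn_gt0.
rewrite /agree; split=> [t|[g [g01 t1 t2]]].
  rewrite t muln1 in H; rewrite -H -big_mkcond sum1_count -has_count in pos.
  case/hasP: pos => b; rewrite mem_paths is_labellingE => /labelling_edge[g -> g01].
  by rewrite revK => /andP[t1 t2]; exists g.
have [_ lg] := edge_labelling (L := L01) g01.
apply/negPn/negP => t; move: H; rewrite (negbTE t) muln0 => /eqP.
apply/negP; rewrite -lt0n -big_mkcond sum1_count -has_count.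
apply/hasP; exists (rev (edge_labels g)); first by rewrite mem_paths is_labellingE.
by rewrite revK t1.
Qed.

(** Being connected to [outer x] is a labelling constant along the strings, so [d x] is connected to
    [x]. Conversely the indicator of [x], [d x] extends over the common edge; it is then constant
    along the strings, which forces [d' x = d x]. *)
Lemma stacks_is_stacking d1 d2 d es : stacks d1 d2 d es ->
  forall d', is_stacking d1 d2 d' = (d' == d).
Proof.
move=> st d'.
have sd : is_stacking d1 d2 d.
  apply/forallP => x; pose g u : nat := connect (strings d1 d2) (outer x) u.
  have gc u v : strings d1 d2 u v -> g u = g v.
    move=> uv; congr (nat_of_bool _); apply/idP/idP => xu; apply: connect_trans xu _.
      exact: connect1.
    by rewrite joined_sym connect1.
  have g01 u : g u \in [:: 0; 1]%N by rewrite /g; case: connect.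
  pose f i := g (outer (inl i)); pose h i := g (outer (inr i)).
  suff /agreeP/(_ x) : agree d f h.
    have E y : glue f h y = g (outer y) by case: y.
    by rewrite !E /g connect0 => /esym/eqP; rewrite eqb1.
  apply/(stacks_agree st) => [i|i|]; [exact: g01|exact: g01|].
  exists (fun i => g (mid_row, i)); split=> [i||]; first exact: g01.
    apply/agreeP => y; have := gc _ _ (strings_upper d1 d2 y).
    by case: (d1 y) => ?; case: y.
  apply/agreeP => y; have := gc _ _ (strings_lower d1 d2 y).
  by case: (d2 y) => ?; case: y.
apply/idP/eqP => [sd'|->//].
apply: val_inj; apply/ffunP => x /=.
pose f i : nat := (inl i == x) || (inl i == d x).
pose h i : nat := (inr i == x) || (inr i == d x).
have E y : glue f h y = (y == x) || (y == d x) :> nat by case: y.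
have : agree d f h.
  apply/agreeP => y; rewrite !E (inj_eq (inv_inj (diagramK d))).
  by rewrite (can2_eq (diagramK d) (diagramK d)) orbC.
case/(stacks_agree st) => [i|i|g [_ a1 a2]].
- by rewrite /f; case: (_ || _).
- by rewrite /h; case: (_ || _).
have := joined_tri a1 a2 (forallP sd' x); rewrite !tri_outer !E eqxx /=.
have /and3P[_ _ /negbTE->] := diagram_matching d' (mem_bpts x).
by move=> /esym/eqP; rewrite eqb1 => /eqP.
Qed.

Lemma prod_const_count j (es : seq nat) :
  (\prod_(c <- es) size (if c == j then [:: 0; 1] else [:: 0]) =
   2 ^ count_mem j es)%N.
Proof.
elim: es => [|c es IH]; first by rewrite big_nil.
by rewrite big_cons IH /=; case: eqP => _; rewrite ?mul1n ?add1n ?expnS.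
Qed.

Lemma zero_labelling L : (forall c, 0%N \in L c) ->
  is_labelling L word (edge_labels (fun _ : 'I_N => 0%N)) /\
  is_labelling L (rev word) (rev (edge_labels (fun _ : 'I_N => 0%N))).
Proof. by move=> L0; apply: edge_labelling. Qed.

Lemma tev_zero d :
  tev [::] (code d) (edge_labels (fun _ : 'I_N => 0%N) ++ rev (edge_labels
    (fun _ : 'I_N => 0%N))).
Proof. by rewrite tev_code; apply/forallP => -[i|i]; case: (d _). Qed.

(** Two labels for colour [j], one for the others and zero on the outer edges: the same count is a
    power of two with exponent the number of loops by [card_loops], and the multiplicity of [j] in
    [es] by [stacks]. *)
Lemma stacks_loops d1 d2 d es (j : 'I_m) :
  stacks d1 d2 d es -> #|loops d1 d2 j| = count_mem (j : nat) es.
Proof.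
case=> _ H.
have [|l1 l2] := @zero_labelling (fun c => if c == j then [:: 0; 1]%N else [:: 0%N]).
  by move=> c; case: ifP.
have := etrans (esym (card_loops d1 d2 j)) (H _ _ _ _ l1 l2).
rewrite tev_zero muln1 prod_const_count => /(_ _)/eqP; rewrite eqn_exp2l // => E.
by apply/eqP; apply: E => c; case: ifP.
Qed.

(** Both bracketings count the labellings of the two inner edges. Giving two labels to a single
    colour compares its multiplicities among the removed loops; once these agree, the labellings by
    [0] and [1] identify the diagrams. *)
Lemma stacks_assoc d1 d2 d3 d12 d23 d d' e12 e23 e e' :
  stacks d1 d2 d12 e12 -> stacks d12 d3 d e ->
  stacks d2 d3 d23 e23 -> stacks d1 d23 d' e' ->
  d = d' /\ perm_eq (e12 ++ e) (e23 ++ e').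
Proof.
move=> [_ h12] [_ h] [_ h23] [_ h'].
have H L bs br : (forall c, uniq (L c)) ->
    is_labelling L word bs -> is_labelling L (rev word) br ->
    (\prod_(c <- e12 ++ e) size (L c) * tev [::] (code d) (bs ++ br) =
     \prod_(c <- e23 ++ e') size (L c) * tev [::] (code d') (bs ++ br))%N.
  move=> uL lbs lbr; rewrite !big_cat /= -!mulnA -h // -h' //.
  rewrite !big_distrr /=.
  transitivity (\sum_(c <- labellings L (rev word))
      \sum_(b <- labellings L (rev word))
        (tev [::] (code d1) (bs ++ b) && tev [::] (code d2) (rev b ++ c)) *
         tev [::] (code d3) (rev c ++ br))%N.
    apply: eq_big_seq => c; rewrite mem_paths is_labellingE => lc.
    by rewrite -mulnb mulnA -h12 // big_distrl.
  rewrite exchange_big /=.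
  apply: eq_big_seq => b; rewrite mem_paths is_labellingE => lb.
  rewrite -mulnb mulnCA -h23 ?big_distrr //=; last first.
    by have := lb; rewrite -is_labelling_rev revK.
  by apply: eq_bigr => c _; rewrite -!mulnb mulnA.
have cnt j : count_mem j (e12 ++ e) = count_mem j (e23 ++ e').
  have [|l1 l2] := @zero_labelling (fun c => if c == j then [:: 0; 1]%N else [:: 0%N]).
    by move=> c; case: ifP.
  have := H _ _ _ _ l1 l2; rewrite !tev_zero !muln1 !prod_const_count => /(_ _)/eqP.
  rewrite eqn_exp2l // => E; apply/eqP; apply: E => c; by case: ifP.
split; last by apply/allP => c _ /=; rewrite cnt.
apply: code_separated => beta b01.
have [bs [br [lbs lbr -> _ _]]] := labelling_bpts (L := L01) b01.
have := H L01 _ _ (fun=> isT) lbs lbr.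
have -> : (\prod_(c <- e12 ++ e) size (L01 c) = \prod_(c <- e23 ++ e') size (L01 c))%N.
  by apply: perm_big; apply/allP => c _ /=; rewrite cnt.
by move/eqP; rewrite eqn_pmul2l ?prodn_gt0 //; do 2!case: tev.
Qed.

End Product.

Section ComposeCodes.
Variables (X : eqType) (F : fieldType) (nbr : nat -> X -> seq X) (mu : X -> F).
Variable a : nat -> F.
Hypothesis nbr_sym : forall c x y, y \in nbr c x -> x \in nbr c y.
Hypothesis nbr_uniq : forall c x, uniq (nbr c x).
Hypothesis mu_neq0 : forall c x y, y \in nbr c x -> mu y != 0.
Hypothesis mu_sum : forall c x, mu x != 0 ->
  \sum_(y <- nbr c x) (mu y / mu x) ^+ 2 = a c.

(** In the concatenation of the two codes the common edge appears as [t] followed by [rev t], which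
    is the situation of [contr_many]. *)
Lemma compose_codes D1 D2 s t r :
  tev [::] D1 (s ++ t) -> tev [::] D2 (rev t ++ r) ->
  exists D es, [/\ tev [::] D (s ++ r), {subset es <= t},
    forall L bs br, (forall c, uniq (L c)) ->
      is_labelling L s bs -> is_labelling L r br ->
      (\sum_(b <- labellings L t)
         (tev [::] D1 (bs ++ b) && tev [::] D2 (rev b ++ br)) =
       \prod_(c <- es) size (L c) * tev [::] D (bs ++ br))%N
  & forall x ps pr (w := last x ps),
      is_path nbr x s ps -> is_path nbr w r pr -> mu w != 0 ->
      \sum_(q <- paths nbr w t)
        mu (last w q) / mu w * ((last w q == x)%:R *
          fev mu [::] D1 x (ps ++ q) *
          fev mu [::] D2 x (rev (belast w q) ++ pr)) =
      \prod_(c <- es) a c * fev mu [::] D x (ps ++ pr)].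
Proof.
move=> t1 t2; have d1 := tev_dyck t1; have s1 := tev_size t1.
have [|D [es [tD sub Tid fid]]] := @contr_many X F nbr mu a nbr_sym nbr_uniq
    mu_neq0 mu_sum t (D1 ++ D2) s r.
  by rewrite catA tev_cat ?s1 // t1.
exists D, es; split=> // [L bs br uL ls lr|x ps pr w lps lpr mu0].
  rewrite -Tid //; apply: eq_big_seq => b; rewrite mem_paths is_labellingE => lb.
  by rewrite (catA bs b) tev_cat // s1 !size_cat (is_labelling_size ls)
    (is_labelling_size lb).
rewrite -fid //; apply: eq_big_seq => q; rewrite mem_paths => lq.
rewrite [in RHS](catA ps q) fev_cat // ?last_cat // s1.
by rewrite !size_cat (is_path_size lps) (is_path_size lq).
Qed.

End ComposeCodes.

(** * The diagram algebra *)

Section Algebra.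
Variables m n : nat.
Hypothesis m_gt0 : (0 < m)%N.
Local Notation N := (m * n)%N.
Local Notation word := (word m n).
Implicit Types d : diagram m n.

Lemma stacks_ex d1 d2 : exists d es, stacks d1 d2 d es.
Proof.
have t1 := code_color d1; have t2 := code_color d2.
rewrite -{1}[word]revK in t2.
(* The combinatorial half of [compose_codes] is extracted by means of the edgeless graph with
   [mu = 0], for which the conditions on the weights are trivial. *)
have [||||D [es [tD sub Tid _]]] := @compose_codes unit rat (fun _ _ => [::])
    (fun=> 0) (fun=> 0) _ _ _ _ _ _ _ _ _ t1 t2 => //.
by have [d Ed] := code_ex tD; exists d, es; rewrite /stacks Ed; split.
Qed.

Lemma tev_opening st k D bs r : size bs = k ->
  tev st (nseq k true ++ D) (bs ++ r) = tev (rev bs ++ st) D r.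
Proof.
elim: k st bs => [|k IH] st [|b bs] //= [/IH->].
by rewrite rev_cons cat_rcons.
Qed.

Lemma tev_closing st k r : size st = k -> tev st (nseq k false) r = (r == st).
Proof.
elim: k st r => [|k IH] [|b st] [|y r] //= [/IH->].
by rewrite eqseq_cons.
Qed.

(** All top points open and all bottom points close, so the nested arcs join each top point to the
    bottom point below it. *)
Lemma identity_ex : exists d, forall bs br, size bs = N ->
  tev [::] (code d) (bs ++ br) = (br == rev bs).
Proof.
have H bs br : size bs = N ->
    tev [::] (nseq N true ++ nseq N false) (bs ++ br) = (br == rev bs).
  by move=> sb; rewrite tev_opening // cats0 tev_closing ?size_rev.
have [|d Ed] := @code_ex m n (nseq N true ++ nseq N false).
  by rewrite H ?size_mkseq.
by exists d; rewrite Ed.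
Qed.

Lemma size_word : size word = N.
Proof. exact: size_mkseq. Qed.

Lemma identity_stacks : exists d0, forall d, stacks d0 d d [::] /\ stacks d d0 d [::].
Proof.
have [d0 H0] := identity_ex; exists d0 => d; split; split=> // L bs br uL ls lr.
  have sbs := is_labelling_size ls; rewrite size_word in sbs.
  rewrite big_nil mul1n; under eq_bigr do rewrite H0 // -mulnb.
  rewrite sum_pick ?revK ?mem_paths ?is_labellingE ?is_labelling_rev //.
  by apply: paths_uniq.
have sbr := is_labelling_size lr; rewrite size_rev size_word in sbr.
rewrite big_nil mul1n.
rewrite (eq_big_seq (fun b => (b == br) * tev [::] (code d) (bs ++ b)))%N.
  rewrite sum_pick ?mem_paths ?is_labellingE //.
  by apply: paths_uniq.
move=> b; rewrite mem_paths is_labellingE => /is_labelling_size.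
by rewrite size_rev size_word => sb; rewrite H0 ?size_rev // revK -mulnb mulnC eq_sym.
Qed.

(** [a'] extends [a] to all natural numbers, so that the letters of words can be its arguments. *)
Variables (F : fieldType) (a : 'I_m -> F) (a' : nat -> F).
Hypothesis a'E : forall j : 'I_m, a' j = a j.

Lemma FC_scaleE (c : F) (x : FC F m n) d : (c *: x) d = c * x d.
Proof. by rewrite ffunE. Qed.

Lemma FC_addE (x y : FC F m n) d : (x + y) d = x d + y d.
Proof. by rewrite ffunE. Qed.

Definition delta d : FC F m n := [ffun d' => (d' == d)%:R].

Lemma prod_colors es : {subset es <= rev word} ->
  \prod_(c <- es) a' c = \prod_(j < m) a j ^+ count_mem (j : nat) es.
Proof.
elim: es => [|c es IH] sub.
  by rewrite big_nil big1 // => j _; rewrite expr0.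
rewrite big_cons IH => [|d de]; last by apply: sub; rewrite inE de orbT.
have c_lt : (c < m)%N.
  by apply: (@word_lt m n) => //; rewrite -mem_rev; apply: sub; rewrite inE eqxx.
rewrite /=; under [RHS]eq_bigr do rewrite exprD.
rewrite big_split /=; congr (_ * _).
rewrite (bigD1 (Ordinal c_lt)) //= eqxx expr1 big1 ?mulr1;
  first exact: (a'E (Ordinal c_lt)).
by move=> j; rewrite -val_eqE /= eq_sym => /negbTE->; rewrite expr0.
Qed.

Lemma FCmul_delta d1 d2 d es : stacks d1 d2 d es ->
  FCmul a (delta d1) (delta d2) = (\prod_(c <- es) a' c) *: delta d.
Proof.
move=> st; apply/ffunP => d'; rewrite FC_scaleE !ffunE.
rewrite (bigD1 d1) //= [X in _ + X]big1 ?addr0; last first.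
  move=> e1 /negbTE ne; rewrite big1 // => e2 _.
  by rewrite ffunE ne !mul0r.
have E e2 : is_stacking d1 e2 d' -> e2 != d2 ->
    delta d1 d1 * delta d2 e2 * \prod_(j < m) a j ^+ #|loops d1 e2 j| = 0.
  by move=> _ /negbTE ne; rewrite [delta d2 e2]ffunE ne mulr0 mul0r.
case: (boolP (is_stacking d1 d2 d')) => sd; last first.
  rewrite big1 => [|e2 se2]; last first.
    by apply: E => //; apply: contraNneq sd => <-.
  by move: sd; rewrite (stacks_is_stacking st) => /negbTE->; rewrite mulr0.
rewrite (bigD1 d2 sd) /= [X in _ + X]big1 => [|e2 /andP[s2 n2]]; last exact: E.
rewrite addr0 !ffunE !eqxx !mul1r; move: sd; rewrite (stacks_is_stacking st) => ->.
rewrite mulr1 (prod_colors (proj1 st)); apply: eq_bigr => j _.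
by rewrite (stacks_loops _ st).
Qed.

Lemma FCmul_linearl y : linear (fun x : FC F m n => FCmul a x y).
Proof.
move=> c x x'; apply/ffunP => d.
rewrite FC_addE FC_scaleE !ffunE mulr_sumr -big_split.
apply: eq_bigr => d1 _; rewrite mulr_sumr -big_split.
by apply: eq_bigr => d2 _; rewrite FC_addE FC_scaleE /= !mulrDl !mulrA.
Qed.

Lemma FCmul_linearr x : linear (fun y : FC F m n => FCmul a x y).
Proof.
move=> c y y'; apply/ffunP => d.
rewrite FC_addE FC_scaleE !ffunE mulr_sumr -big_split.
apply: eq_bigr => d1 _; rewrite mulr_sumr -big_split.
apply: eq_bigr => d2 _; rewrite FC_addE FC_scaleE /= mulrDr !mulrDl !mulrA.
by rewrite [x d1 * c]mulrC.
Qed.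

End Algebra.

Section AlgebraLaws.
Variables m n : nat.
Hypothesis m_gt0 : (0 < m)%N.
Variables (F : fieldType) (a : 'I_m -> F) (a' : nat -> F).
Hypothesis a'E : forall j : 'I_m, a' j = a j.
Local Notation FCn := (FC F m n).
Local Notation delta := (@delta m n F).

Lemma linear_sum_seq (V W : lmodType F) (f : V -> W) (I : Type) (r : seq I) c x :
  linear f -> f (\sum_(i <- r) c i *: x i) = \sum_(i <- r) c i *: f (x i).
Proof.
move=> lf; have f0 : f 0 = 0.
  by have := lf (-1) 0 0; rewrite scaler0 addr0 scaleN1r addNr.
by elim: r => [|i r IH]; rewrite ?big_nil // !big_cons lf IH.
Qed.

Lemma FC_expand (x : FCn) : x = \sum_d x d *: delta d.
Proof.
apply/ffunP => d; rewrite sum_ffunE (bigD1 d) //= big1 => [|e /negbTE ne].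
  by rewrite addr0 FC_scaleE ffunE eqxx mulr1.
by rewrite FC_scaleE ffunE eq_sym ne mulr0.
Qed.

Lemma linear_ext (W : lmodType F) (f g : FCn -> W) : linear f -> linear g ->
  (forall d, f (delta d) = g (delta d)) -> f =1 g.
Proof.
move=> lf lg E x; rewrite (FC_expand x) !linear_sum_seq //.
by apply: eq_bigr => d _; rewrite E.
Qed.

Local Notation mul := (@FCmul F m n a).

Lemma FCmul_suml (I : Type) (r : seq I) c (x : I -> FCn) y :
  mul (\sum_(i <- r) c i *: x i) y = \sum_(i <- r) c i *: mul (x i) y.
Proof. exact: linear_sum_seq (FCmul_linearl a y). Qed.

Lemma FCmul_sumr (I : Type) (r : seq I) c (x : I -> FCn) y :
  mul y (\sum_(i <- r) c i *: x i) = \sum_(i <- r) c i *: mul y (x i).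
Proof. exact: linear_sum_seq (FCmul_linearr a y). Qed.

Lemma FCmulZl c x y : mul (c *: x) y = c *: mul x y.
Proof. by have := FCmul_suml [:: tt] (fun=> c) (fun=> x) y; rewrite !big_seq1. Qed.

Lemma FCmulZr c x y : mul x (c *: y) = c *: mul x y.
Proof. by have := FCmul_sumr [:: tt] (fun=> c) (fun=> y) x; rewrite !big_seq1. Qed.

Lemma FCmulA x y z : mul (mul x y) z = mul x (mul y z).
Proof.
have ll := FCmul_linearl a (n := n); have lr := FCmul_linearr a (n := n).
apply: (@linear_ext _ (fun x => mul (mul x y) z) (fun x => mul x (mul y z))) =>
  [c u v|//|d1].
  by rewrite ll ll.
apply: (@linear_ext _ (fun y => mul (mul (delta d1) y) z)
  (fun y => mul (delta d1) (mul y z))) => [c u v|c u v|d2].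
- by rewrite lr ll.
- by rewrite ll lr.
apply: (@linear_ext _ (fun z => mul (mul (delta d1) (delta d2)) z)
  (fun z => mul (delta d1) (mul (delta d2) z))) => [//|c u v|d3].
  by rewrite lr lr.
have [d12 [e12 s12]] := stacks_ex d1 d2.
have [d23 [e23 s23]] := stacks_ex d2 d3.
have [d [e s]] := stacks_ex d12 d3.
have [d' [e' s']] := stacks_ex d1 d23.
have [Ed Ee] := stacks_assoc s12 s s23 s'.
rewrite (FCmul_delta m_gt0 a'E s12) (FCmul_delta m_gt0 a'E s23) FCmulZl FCmulZr.
rewrite (FCmul_delta m_gt0 a'E s) (FCmul_delta m_gt0 a'E s') !scalerA -!big_cat Ed.
by rewrite (perm_big _ Ee).
Qed.

Lemma FCmul_unit : exists e : FCn, forall x, mul e x = x /\ mul x e = x.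
Proof.
have [d0 H] := identity_stacks m n; exists (delta d0) => x.
split.
  apply: (@linear_ext _ (fun x => mul (delta d0) x) id) => [||d] //.
    exact: FCmul_linearr.
  by rewrite (FCmul_delta m_gt0 a'E (proj1 (H d))) big_nil scale1r.
apply: (@linear_ext _ (fun x => mul x (delta d0)) id) => [||d] //.
  exact: FCmul_linearl.
by rewrite (FCmul_delta m_gt0 a'E (proj2 (H d))) big_nil scale1r.
Qed.

End AlgebraLaws.

(** * Regions and their weights *)

Section Chebyshev.
Variables (F : fieldType).

(* The value at [x] of the Chebyshev polynomial determined by
   [sin t * cheb (2 cos t) k = sin ((k + 1) t)]. *)
Fixpoint cheb (x : F) (k : nat) : F :=
  match k with
  | 0 => 1
  | k'.+1 => if k' is k''.+1 then x * cheb x k' - cheb x k'' else x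
  end.

Lemma chebSS x k : cheb x k.+2 = x * cheb x k.+1 - cheb x k.
Proof. by []. Qed.

End Chebyshev.

(* Regions of the plane are words: crossing a string of colour [c] adds or
   removes the letter [c] at the head. *)
Definition tree_nbr (c : nat) (x : seq nat) : seq (seq nat) :=
  (c :: x) :: (if x is h :: x' then if h == c then [:: x'] else [::] else [::]).

Lemma mem_tree_nbr c x y : (y \in tree_nbr c x) = (y == c :: x) || (x == c :: y).
Proof.
rewrite inE; congr (_ || _); case: x => [|h x] //.
by rewrite eqseq_cons; case: eqP => _; rewrite ?inE // eq_sym.
Qed.

Lemma tree_nbr_uniq c x : uniq (tree_nbr c x).
Proof.
rewrite /=; case: x => //= h x; case: eqP => //= _; rewrite inE andbT.
by apply/eqP => /(congr1 size) /=; lia.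
Qed.

Lemma tree_nbr_sym c x y : y \in tree_nbr c x -> x \in tree_nbr c y.
Proof. by rewrite !mem_tree_nbr orbC. Qed.

(** The highest region sequence of [D], read as a stack of colours; [steps] recovers the code from
    it. *)
Fixpoint stack_path (x : seq nat) (D : seq bool) (w : seq nat) : seq (seq nat) :=
  match D, w with
  | b :: D', c :: w' =>
      let y := if b then c :: x else behead x in y :: stack_path y D' w'
  | _, _ => [::]
  end.

Fixpoint steps (x : seq nat) (p : seq (seq nat)) : seq bool :=
  if p is y :: p' then (size x < size y)%N :: steps y p' else [::].

Lemma tev_steps x w p : is_path tree_nbr x w p ->
  tev x (steps x p) w = nilp (last x p).
Proof.
elim: w x p => [|c w IH] x [|y p] // /andP[]; rewrite mem_tree_nbr.
move=> /orP[/eqP->|/eqP->] /IH /=; first by rewrite leqnn.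
by rewrite ltnNge leqnSn eqxx.
Qed.

Lemma stack_path_steps x w p : is_path tree_nbr x w p ->
  stack_path x (steps x p) w = p.
Proof.
elim: w x p => [|c w IH] x [|y p] // /andP[]; rewrite mem_tree_nbr.
move=> /orP[/eqP->|/eqP->] /IH /= E; first by rewrite leqnn E.
by rewrite ltnNge leqnSn E.
Qed.

Lemma tev_stack_path x D w : tev x D w ->
  is_path tree_nbr x w (stack_path x D w) /\ last x (stack_path x D w) = [::].
Proof.
elim: D x w => [|b D IH] x [|c w] //=; try by case: b.
  by move/nilP.
case: b => [/IH[p l]|]; first by rewrite mem_tree_nbr eqxx.
by case: x => // h x /andP[/eqP<- /IH[p l]]; rewrite mem_tree_nbr eqxx orbT.
Qed.

Lemma steps_stack_path x D w : tev x D w -> steps x (stack_path x D w) = D.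
Proof.
elim: D x w => [|b D IH] x [|c w] //=; try by case: b.
case: b => [/IH E|]; first by rewrite leqnn E.
by case: x => // h x /andP[_ /IH E] /=; rewrite E ltnNge leqnSn.
Qed.

(** Comparable words of the same length are equal; hence comparable sequences of the same total
    height are equal, which makes the matrices triangular. *)
Definition below (x y : seq nat) := (size x < size y)%N || (x == y).

Definition heights (p : seq (seq nat)) := sumn (map size p).

Lemma below_heights p q : all2 below p q ->
  (heights p <= heights q)%N /\ (heights p = heights q -> p = q).
Proof.
elim: p q => [|x p IH] [|y q] //= /andP[xy /IH[le E]];
  rewrite /heights /= -!/(heights _).
have le_xy : (size x <= size y)%N by case/orP: xy => [/ltnW|/eqP->].
split; first exact: leq_add.
move=> e; case/orP: xy => [xy|/eqP<-]; first by exfalso; move: e le xy; lia.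
by rewrite E //; move: e le le_xy; lia.
Qed.

Section StackModel.
Variables (F : fieldType) (mu : seq nat -> F).
Implicit Type st : seq (seq nat * seq nat).

(** Invariant of the next induction: the outer region of each pending arc is below the tail of [y]
    that is exposed when the arc closes. *)
Fixpoint stack_below st (y : seq nat) : bool :=
  match st, y with
  | [::], [::] => true
  | (o, i) :: st', c :: y' => below o y' && stack_below st' y'
  | _, _ => false
  end.

(** At an opening the stack path gains a letter, while any path changes its length by one. At a
    closing a nonzero value forces the return to the recorded outer region, which is below by the
    invariant. *)
Lemma fev_below_st st D x y w p : tev y D w -> is_path tree_nbr x w p ->
  below x y -> stack_below st y -> fev mu st D x p != 0 ->
  all2 below p (stack_path y D w).
Proof.
elim: D st x y w p => [|b D IH] st x y [|c w] [|z p] //=; try by case: b.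
case: b => /= ty /andP[zx pw] xy sty.
  have zy : below z (c :: y).
    move: zx; rewrite mem_tree_nbr => /orP[/eqP->|/eqP Ex].
      by case/orP: xy => [xy|/eqP->]; rewrite /below /= ?eqxx ?orbT // ltnS xy.
    by apply/orP; left => /=; rewrite {}Ex in xy; case/orP: xy => [|/eqP<-] /=; lia.
  by move=> ne0; rewrite zy; apply: (IH ((x, z) :: st) z); rewrite //= ?xy.
case: y ty xy sty => // d y /andP[/eqP<- ty] xy; case: st => //= -[o i] st.
move=> /andP[oy sty]; case: (x == i); last by rewrite /= !mul0r eqxx.
case: (z =P o) => [Ez|_]; last by rewrite !mul0r eqxx.
rewrite mulf_eq0 negb_or => /andP[_ ne0]; rewrite Ez oy /=.
by apply: (IH st z); rewrite -?Ez // Ez.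
Qed.

Lemma fev_below D w p : tev [::] D w -> is_path tree_nbr [::] w p ->
  fev mu [::] D [::] p != 0 -> all2 below p (stack_path [::] D w).
Proof. by move=> tD pw; apply: fev_below_st. Qed.

Fixpoint stack_exact st (y : seq nat) : bool :=
  match st, y with
  | [::], [::] => true
  | (o, i) :: st', c :: y' => [&& o == y', i == c :: y' & stack_exact st' y']
  | _, _ => false
  end.

Lemma fev_stack_path_st st D y w : tev y D w -> stack_exact st y ->
  (forall x, mu x != 0) -> fev mu st D y (stack_path y D w) != 0.
Proof.
move=> + + mu0; elim: D st y w => [|b D IH] st y [|c w] //; try by case: b.
  by case: y => //; case: st => [|[]] // _ _; rewrite /= oner_eq0.
case: b => /= ty sty; first by apply: IH; rewrite //= !eqxx.
case: y ty sty => // d y /andP[_ ty]; case: st => //= -[o i] st.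
move=> /and3P[/eqP-> /eqP-> sty]; rewrite !eqxx mul1r.
by rewrite !mulf_neq0 ?invr_neq0 // IH.
Qed.

Lemma fev_stack_path D w : tev [::] D w -> (forall x, mu x != 0) ->
  fev mu [::] D [::] (stack_path [::] D w) != 0.
Proof. by move=> tD mu0; apply: fev_stack_path_st. Qed.

End StackModel.

Section Weights.
Variables (F : numClosedFieldType) (a : nat -> F).

Definition run (c : nat) (x : seq nat) := find (predC1 c) x.

(** Adding [c] to a run of [k] letters [c] replaces the factor [U_k] by [U_(k+1)], whence the
    quotient. A word that extends one of weight zero has weight zero. *)
Fixpoint weight (x : seq nat) : F :=
  if x is c :: x'
  then weight x' * (cheb (a c) (run c x').+1 / cheb (a c) (run c x')) else 1.

Lemma weight_cons c x :
  weight (c :: x) = weight x * (cheb (a c) (run c x).+1 / cheb (a c) (run c x)).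
Proof. by []. Qed.

Definition mu x := sqrtC (weight x).

Lemma mu_eq0 x : (mu x == 0) = (weight x == 0).
Proof. exact: sqrtC_eq0. Qed.

(** Words with [mu x = 0] are given no neighbours, which keeps the adjacency symmetric. *)
Definition nbr c x :=
  if mu x == 0 then [::] else [seq y <- tree_nbr c x | mu y != 0].

Lemma mem_nbr c x y :
  (y \in nbr c x) = [&& mu x != 0, mu y != 0 & y \in tree_nbr c x].
Proof. by rewrite /nbr; case: ifP => // _; rewrite mem_filter. Qed.

Lemma nbr_sym c x y : y \in nbr c x -> x \in nbr c y.
Proof. by rewrite !mem_nbr => /and3P[-> -> /tree_nbr_sym->]. Qed.

Lemma nbr_uniq c x : uniq (nbr c x).
Proof. by rewrite /nbr; case: ifP => // _; rewrite filter_uniq ?tree_nbr_uniq. Qed.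

Lemma nbr_mu c x y : y \in nbr c x -> mu y != 0.
Proof. by rewrite mem_nbr => /and3P[]. Qed.

Lemma weight_cons_neq0 c x : weight (c :: x) != 0 ->
  [/\ weight x != 0, cheb (a c) (run c x).+1 != 0 & cheb (a c) (run c x) != 0].
Proof. by rewrite /= !mulf_eq0 !negb_or invr_eq0 => /andP[-> /andP[-> ->]]. Qed.

(** If [x] starts with exactly [k > 0] letters [c], its neighbours contribute [U_(k+1) / U_k] and
    [U_(k-1) / U_k], and the recursion applies; for [k = 0] there is only [U_1 / U_0 = a c].
    Discarded neighbours have weight zero. *)
Lemma mu_sum c x : mu x != 0 -> \sum_(y <- nbr c x) (mu y / mu x) ^+ 2 = a c.
Proof.
move=> mux; rewrite /nbr (negbTE mux) big_filter big_mkcond /=.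
rewrite mu_eq0 in mux.
rewrite (eq_bigr (fun y => weight y / weight x)) => [|y _]; last first.
  rewrite expr_div_n !sqrtCK; case: (mu y =P 0) => // /eqP.
  by rewrite mu_eq0 => /eqP->; rewrite mul0r.
rewrite big_cons weight_cons mulrAC divff // mul1r.
case: x mux => [|h x] mux; first by rewrite big_nil addr0 divr1.
case: (h =P c) mux => [->|ne] mux; last first.
  by rewrite big_nil addr0 /run /= (introF eqP ne) /= divr1.
have [wx u1 u0] := weight_cons_neq0 mux.
rewrite big_seq1 weight_cons (_ : run c (c :: x) = (run c x).+1); last first.
  by rewrite /run /= eqxx.
by rewrite chebSS; field; rewrite wx u1 u0.
Qed.

Lemma weight_neq0 x : (forall c k, cheb (a c) k != 0) -> weight x != 0.
Proof.
move=> ne0; elim: x => /= [|c x IH]; first exact: oner_neq0.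
by rewrite !mulf_eq0 invr_eq0 !negb_or IH -/(cheb (a c) (run c x).+1) !ne0.
Qed.

Lemma weight_cat_eq0 u x : weight x = 0 -> weight (u ++ x) = 0.
Proof. by move=> x0; elim: u => //= c u ->; rewrite mul0r. Qed.

Lemma weight_run_eq0 K c x : cheb (a c) K = 0 -> run c x = 0%N ->
  weight (nseq K c ++ x) = 0.
Proof.
case: K => [/eqP|K K0 rx]; first by rewrite oner_eq0.
rewrite -[_ ++ _]/(c :: (nseq K c ++ x)) weight_cons.
rewrite (_ : run c (nseq K c ++ x) = K) ?K0 ?mul0r ?mulr0 //.
by rewrite /run in rx *; elim: (K) => //= k ->; rewrite eqxx.
Qed.

End Weights.

(** * The generic case *)

Section MatrixUnits.
Variables (F : fieldType) (A : vectType F) (mul : A -> A -> A).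
Variables (k : nat) (T : eqType) (e : 'I_k -> T) (rho : A -> 'M[F]_k).
Hypothesis rho_lin : linear rho.
Hypothesis rho_inj : injective rho.
Hypothesis rhoM : forall x y, rho (mul x y) = rho x *m rho y.
Hypothesis rho_block : forall x i j, e i != e j -> rho x i j = 0.
Hypothesis rho_surj : forall i j, e i = e j -> exists x, rho x = delta_mx i j.

(** [rho] identifies the algebra with the block matrices for the fibres of [e]; the matrices
    supported in one column form the simple left ideals. *)
Lemma semisimple_block : semisimple mul.
Proof.
have rho0 : rho 0 = 0.
  by have := rho_lin (-1) 0 0; rewrite scaler0 addr0 scaleN1r addNr.
have rho_sum (I : Type) (r : seq I) c x :
  rho (\sum_(i <- r) c i *: x i) = \sum_(i <- r) c i *: rho (x i).
  exact: linear_sum_seq rho_lin.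
have rho_sum1 (I : Type) (r : seq I) x :
    rho (\sum_(i <- r) x i) = \sum_(i <- r) rho (x i).
  elim: r => [|i r IH]; rewrite ?big_nil // !big_cons -IH.
  by have := rho_lin 1 (x i) (\sum_(i <- r) x i); rewrite !scale1r.
have rhoZ c x : rho (c *: x) = c *: rho x.
  by have := rho_lin c x 0; rewrite rho0 !addr0.
(* [B (i, j)] is the preimage of a matrix unit, or zero when [i] and [j] lie in different blocks. *)
have /fin_all_exists[B HB] (p : 'I_k * 'I_k) :
    exists x, rho x = (e p.1 == e p.2)%:R *: delta_mx p.1 p.2.
  case: eqP => [/rho_surj[x <-]|_]; first by exists x; rewrite scale1r.
  by exists 0; rewrite rho0 scale0r.
have HBE i j i' j' : rho (B (i, j)) i' j' = ((e i == e j) && (i' == i) && (j' == j))%:R.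
  by rewrite HB !mxE /= -natrM mulnb andbA.
pose U j := (\sum_(i < k) <[B (i, j)]>)%VS.
have dec j x : (forall i' j', j' != j -> rho x i' j' = 0) ->
    x = \sum_(i < k) rho x i j *: B (i, j).
  move=> x0; apply: rho_inj; apply/matrixP => i' j'; rewrite rho_sum summxE.
  rewrite (bigD1 i') //= big1 => [|i /negbTE ni]; last first.
    by rewrite mxE HBE (eq_sym i') ni andbF /= mulr0.
  rewrite mxE HBE eqxx andbT addr0; have [->|nj] := eqVneq j' j; last first.
    by rewrite x0 // andbF mulr0.
  by rewrite andbT; case: eqP => [_|/eqP ne]; rewrite ?mulr1 // rho_block // mul0r.
have memU j x : reflect (forall i' j', j' != j -> rho x i' j' = 0) (x \in U j).
  apply: (iffP idP) => [|x0]; last first.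
    by rewrite (dec _ _ x0); apply: memv_sumr => i _; rewrite memvZ ?memv_line.
  move/memv_sumP => [v vB ->] i' j' nj.
  have /fin_all_exists[c Hc] i : exists c, v i = c *: B (i, j).
    by apply/vlineP; exact: vB.
  under eq_bigr do rewrite Hc; rewrite rho_sum summxE big1 // => i _.
  by rewrite mxE HBE (negbTE nj) andbF mulr0.
exists k, U; split.
- move=> j; split.
  + move=> x u /memU uU; apply/memU => i' j' nj; rewrite rhoM mxE big1 // => l _.
    by rewrite uU // mulr0.
  + apply/eqP => U0.
    have : B (j, j) \in U j by apply/memU => i' j' nj; rewrite HBE (negbTE nj) andbF.
    rewrite U0 memv0 => /eqP B0; have := HBE j j j j.
    by rewrite B0 rho0 mxE !eqxx => /esym/eqP; rewrite oner_eq0.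
  move=> W idW WU; have [->|W0] := eqVneq W 0%VS; [by left|right].
  apply/eqP; rewrite eqEsubv WU; apply/subv_sumP => i _; rewrite -memvE.
  pose x := vpick W; have xW : x \in W by exact: memv_pick.
  have /memU xU := subvP WU _ xW.
  have x0 : x != 0 by rewrite vpick0.
  have [i0 xi0] : exists i0, rho x i0 j != 0.
    apply/existsP; rewrite -negb_forall; apply: contraNN x0 => /forallP H.
    rewrite (dec _ _ xU) big1 // => i1 _; have /eqP-> := H i1; exact: scale0r.
  have ei0 : e i0 = e j by apply/eqP; apply: contraNT xi0 => /rho_block->.
  have [ei|ne] := eqVneq (e i) (e j); last first.
    rewrite (_ : B _ = 0) ?mem0v //; apply: rho_inj.
    by rewrite rho0 HB /= (negbTE ne) scale0r.
  (* Multiplication by a matrix unit moves the nonzero entry of [x] from row [i0] to row [i], so [x]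
     generates the whole column. *)
  suff E : mul (B (i, i0)) x = rho x i0 j *: B (i, j).
    have := idW (B (i, i0)) x xW; rewrite E => /(memvZ (rho x i0 j)^-1).
    by rewrite scalerA mulVf // scale1r.
  apply: rho_inj; apply/matrixP => i' j'; rewrite rhoM rhoZ !mxE HBE ei eqxx.
  rewrite (bigD1 i0) //= big1 => [|l /negbTE nl]; last first.
    by rewrite HBE nl andbF mul0r.
  rewrite HBE ei ei0 !eqxx andbT addr0 /=; have [->|nj] := eqVneq j' j.
    by rewrite andbT mulrC.
  by rewrite xU // andbF !mulr0.
- apply/directv_sum_independent => u uU u0 j _.
  have /memU uj := uU j isT; rewrite (dec _ _ uj) big1 // => i _.
  have := congr1 (fun M : 'M_k => M i j) rho0; rewrite -[in rho 0]u0.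
  rewrite rho_sum1 summxE (bigD1 j) //= big1 => [|l nl].
    by rewrite addr0 mxE => ->; rewrite scale0r.
  have /memU ul := uU l isT; by rewrite ul // eq_sym.
- apply/eqP; rewrite eqEsubv subvf; apply/subvP => x _.
  have -> : x = \sum_(j < k) \sum_(i < k) rho x i j *: B (i, j).
    apply: rho_inj; apply/matrixP => i' j'.
    rewrite rho_sum1 summxE (bigD1 j') //= [X in _ + X]big1 => [|l nl]; last first.
      rewrite rho_sum summxE big1 // => i _.
      by rewrite mxE HBE (eq_sym j') (negbTE nl) andbF mulr0.
    rewrite addr0 rho_sum summxE (bigD1 i') //= big1 => [|i /negbTE ni].
      rewrite addr0 mxE HBE !eqxx !andbT.
      by case: eqP => [_|/eqP ne]; rewrite ?mulr1 // rho_block // mul0r.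
    by rewrite mxE HBE (eq_sym i') ni andbF mulr0.
  apply: memv_suml => j _; apply: (subvP (sumv_sup j isT (subvv _))).
  by apply: memv_sumr => i _; rewrite memvZ ?memv_line.
Qed.

End MatrixUnits.

Section Reversal.
Variables (X : eqType) (nbr : nat -> X -> seq X).
Hypothesis nbr_sym : forall c x y, y \in nbr c x -> x \in nbr c y.
Hypothesis nbr_uniq : forall c x, uniq (nbr c x).

Lemma last_rev_belast (x : X) p : last (last x p) (rev (belast x p)) = x.
Proof. by case: p => //= y p; rewrite rev_cons last_rcons. Qed.

Lemma rev_belast_rev (x : X) p : rev (belast (last x p) (rev (belast x p))) = p.
Proof.
case/lastP: p => // p y.
by rewrite last_rcons belast_rcons rev_cons belast_rcons rev_cons revK.
Qed.

Lemma big_paths_rev (R : Type) (idx : R) (op : Monoid.com_law idx) x w t f :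
  \big[op/idx]_(q <- paths nbr w (rev t) | last w q == x) f q =
  \big[op/idx]_(p <- paths nbr x t | last x p == w) f (rev (belast x p)).
Proof.
rewrite -big_filter -[RHS]big_filter.
rewrite -(big_map (fun p => rev (belast x p)) predT f).
apply: perm_big; apply: uniq_perm.
- by rewrite filter_uniq ?paths_uniq.
- rewrite map_inj_in_uniq ?filter_uniq ?paths_uniq // => p q.
  rewrite !mem_filter => /andP[/eqP lp _] /andP[/eqP lq _] E.
  by rewrite -[p](rev_belast_rev x) -[q](rev_belast_rev x) lp lq E.
move=> q; rewrite mem_filter mem_paths; apply/andP/mapP => [[/eqP lq wq]|[p]].
  exists (rev (belast w q)); last by rewrite -lq rev_belast_rev.
  by rewrite mem_filter mem_paths -lq last_rev_belast eqxx -[t]revK is_path_rev.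
rewrite mem_filter mem_paths => /andP[/eqP lp xp] ->.
by rewrite -lp last_rev_belast is_path_rev.
Qed.

End Reversal.

(** * The representation on region sequences *)

Section Representation.
Variables m n : nat.
Hypothesis m_gt0 : (0 < m)%N.
Variables (F : numClosedFieldType) (a : 'I_m -> F) (a' : nat -> F).
Hypothesis a'E : forall j : 'I_m, a' j = a j.
Local Notation word := (word m n).
Local Notation mu := (mu a').
Local Notation delta := (@delta m n F).
Local Notation nbr := (nbr a').
Local Notation P := (paths nbr [::] word).
Local Notation k := (size P).
Implicit Types d : diagram m n.

(** A matrix index stands for a sequence of regions along an edge; its last region, [through i],
    touches the right side of the rectangle, where both edges must agree. *)
Let top (i : 'I_k) : seq (seq nat) := nth [::] P i.
Let through (i : 'I_k) : seq nat := last [::] (top i).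

Definition contour (p q : seq (seq nat)) := p ++ rev (belast [::] q).

(** The factor [mu [::] / mu (through i)] is the one that [compose_codes] attaches to a sequence on
    the common edge; it makes [rho] multiplicative. *)
Definition rho (x : FC F m n) : 'M[F]_k := \matrix_(i, j)
  if through i == through j then
    mu [::] / mu (through i) *
      \sum_d x d * fev mu [::] (code d) [::] (contour (top i) (top j))
  else 0.

Lemma top_path i : is_path nbr [::] word (top i).
Proof. by rewrite -mem_paths mem_nth. Qed.

Lemma through_mu i : mu (through i) != 0.
Proof.
apply: mu_last (top_path i) _ => [c x y /nbr_mu //|].
by rewrite mu_eq0 oner_neq0.
Qed.

Lemma rho_linear : linear rho.
Proof.
move=> c x y; apply/matrixP => i j; rewrite !mxE.
case: ifP => _; last by rewrite mulr0 addr0.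
rewrite mulrCA -mulrDr; congr (_ * _); rewrite mulr_sumr -big_split /=.
by apply: eq_bigr => d _; rewrite FC_addE FC_scaleE mulrDl mulrA.
Qed.

Lemma rho_delta d i j : rho (delta d) i j =
  if through i == through j then mu [::] / mu (through i) *
    fev mu [::] (code d) [::] (contour (top i) (top j)) else 0.
Proof.
rewrite mxE; case: ifP => // _; congr (_ * _).
rewrite (bigD1 d) //= big1 ?addr0 => [|e /negbTE ne].
  by rewrite ffunE eqxx mul1r.
by rewrite ffunE ne mul0r.
Qed.

Lemma rho_block x i j : through i != through j -> rho x i j = 0.
Proof. by rewrite mxE => /negbTE->. Qed.

Lemma rho_mul_delta d1 d2 :
  rho (FCmul a (delta d1) (delta d2)) = rho (delta d1) *m rho (delta d2).
Proof.
have t1 := code_color d1; have t2 := code_color d2.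
rewrite -{1}[word]revK in t2.
have [D [es [tD sub Tid fid]]] := compose_codes (@nbr_sym _ a') (@nbr_uniq _ a')
  (@nbr_mu _ a') (@mu_sum _ a') t1 t2.
have [d Ed] := code_ex tD.
have st : stacks d1 d2 d es by rewrite /stacks Ed.
rewrite (FCmul_delta m_gt0 a'E st); apply/matrixP => i j.
have rhoZ c x : rho (c *: x) i j = c * rho x i j.
  have := rho_linear c x 0; have := rho_linear (-1) 0 0.
  rewrite scaler0 addr0 scaleN1r addNr => ->; rewrite !addr0 => ->.
  by rewrite mxE.
rewrite rhoZ rho_delta mxE.
case: eqP => [eij|ne]; last first.
  rewrite mulr0 big1 // => l _; case: (through i =P through l) => [Eil|nil]; last first.
    by rewrite rho_block ?mul0r //; apply/eqP.
  by rewrite [rho _ l j]rho_block ?mulr0 // -Eil; apply/eqP.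
have pj : is_path nbr (through i) (rev word) (rev (belast [::] (top j))).
  by rewrite eij is_path_rev ?top_path //; exact: nbr_sym.
have := fid _ _ _ (top_path i) pj (through_mu i).
rewrite -/(through i) => /(congr1 (fun z => mu [::] / mu (through i) * z)).
rewrite mulrCA -Ed => <-.
rewrite mulr_sumr (bigID (fun q => last (through i) q == [::])) /= [X in _ + X]big1
  ?addr0; last first.
  by move=> q /negbTE->; rewrite !mul0r !mulr0.
(* The common edge is run from right to left; reversed, its sequences starting at [through i] and
   ending at [[::]] are the indices [l] of the matrix product. *)
rewrite (big_paths_rev (@nbr_sym _ a') (@nbr_uniq _ a'))
  (big_nth [::]) big_mkord big_mkcond /=.
apply: eq_bigr => l _; rewrite -/(top l) -/(through l) !rho_delta.
rewrite [through i == _]eq_sym -eij; case: (through l =P through i) => [Eli|_];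
  last first.
  by rewrite mul0r.
rewrite -Eli last_rev_belast eqxx rev_belast_rev mul1r /contour; ring.
Qed.

Lemma rho_mul x y : rho (FCmul a x y) = rho x *m rho y.
Proof.
have ll := FCmul_linearl a (n := n); have lr := FCmul_linearr a (n := n).
have rl := rho_linear.
move: x;
  apply: (@linear_ext m n F _ (fun x => rho (FCmul a x y)) (fun x => rho x *m rho y)).
- by move=> c u v; rewrite ll rl.
- by move=> c u v; rewrite rl mulmxDl scalemxAl.
move=> d1; move: y; apply: (@linear_ext m n F _ (fun y => rho (FCmul a (delta d1) y))
   (fun y => rho (delta d1) *m rho y)).
- by move=> c u v; rewrite lr rl.
- by move=> c u v; rewrite rl mulmxDr scalemxAr.
exact: rho_mul_delta.
Qed.

Hypothesis cheb_neq0 : forall c j, cheb (a' c) j != 0.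

Lemma mu_neq0 x : mu x != 0.
Proof. by rewrite mu_eq0 weight_neq0. Qed.

Lemma is_path_nbrE x w p : is_path nbr x w p = is_path tree_nbr x w p.
Proof.
elim: w x p => [|c w IH] x [|y p] //=.
by rewrite IH mem_nbr !mu_neq0.
Qed.

Let loop (ij : 'I_k * 'I_k) := contour (top ij.1) (top ij.2).
Let stack d := stack_path [::] (code d) (word ++ rev word).

Lemma loop_path ij : through ij.1 = through ij.2 ->
  is_path tree_nbr [::] (word ++ rev word) (loop ij) /\ last [::] (loop ij) = [::].
Proof.
move=> E; rewrite -is_path_nbrE is_path_cat ?(is_path_size (top_path _)) //.
rewrite top_path /= last_cat -/(through _) E last_rev_belast; split=> //.
by apply: is_path_rev (top_path _); exact: nbr_sym.
Qed.

Lemma top_inj : injective top.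
Proof.
move=> i j /eqP; rewrite nth_uniq //; first by move=> /eqP/val_inj.
by apply: paths_uniq => c x; exact: nbr_uniq.
Qed.

Lemma loop_inj ij ij' : loop ij = loop ij' -> through ij.1 = through ij.2 ->
  through ij'.1 = through ij'.2 -> ij = ij'.
Proof.
case: ij ij' => i j [i' j']; rewrite /loop /contour /= => /eqP.
rewrite eqseq_cat ?(is_path_size (top_path _)) // => /andP[/eqP/top_inj<- /eqP E] e e'.
congr (_, _); apply: top_inj;
  rewrite -[LHS](rev_belast_rev [::]) -[RHS](rev_belast_rev [::]) E.
by rewrite -/(through _) -/(through _) -e -e'.
Qed.

Lemma stack_loop d : exists2 ij, through ij.1 = through ij.2 & loop ij = stack d.
Proof.
have [sp sl] := tev_stack_path (code_color d).
rewrite -/(stack d) -is_path_nbrE in sp sl.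
have ss : size (stack d) = (size word + size word)%N.
  by rewrite (is_path_size sp) size_cat size_rev.
have [|p [q [Es sp1]]] := @split_cat _ (size word) (stack d);
  first by rewrite ss leq_addr.
rewrite Es is_path_cat // in sp; case/andP: sp => pp pq.
rewrite Es last_cat in sl.
have qq := is_path_rev (@nbr_sym _ a') pq; rewrite revK sl in qq.
have ip : p \in P by rewrite mem_paths.
have iq : rev (belast (last [::] p) q) \in P by rewrite mem_paths.
exists (Ordinal (etrans (index_mem _ _) ip), Ordinal (etrans (index_mem _ _) iq)).
  rewrite /through /top /= !nth_index //.
  by rewrite -[X in last X (rev _)]sl last_rev_belast.
rewrite /loop /contour /top /= !nth_index // Es; congr (_ ++ _).
by rewrite -[X in belast X (rev _)]sl rev_belast_rev.
Qed.

Lemma loop_code ij : through ij.1 = through ij.2 -> exists d, stack d = loop ij.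
Proof.
move=> /loop_path[lp ll].
have [|d Ed] := @code_ex m n (steps [::] (loop ij)); first by rewrite tev_steps // ll.
by exists d; rewrite /stack Ed stack_path_steps.
Qed.

Lemma fev_loop d ij : through ij.1 = through ij.2 ->
  fev mu [::] (code d) [::] (loop ij) != 0 -> loop ij != stack d ->
  (heights (loop ij) < heights (stack d))%N.
Proof.
move=> /loop_path[lp _] ne0 nst.
have [le E] := below_heights (fev_below (code_color d) lp ne0).
by rewrite ltn_neqAle le andbT; apply: contraNneq nst => /E->.
Qed.

Lemma fev_stack d : fev mu [::] (code d) [::] (stack d) != 0.
Proof. exact: fev_stack_path (code_color d) mu_neq0. Qed.

Lemma norm_neq0 i : mu [::] / mu (through i) != 0.
Proof. by rewrite mulf_neq0 ?invr_neq0 ?mu_neq0. Qed.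

(** Among the diagrams with nonzero coefficient, let [d0] have a highest sequence of maximal height:
    at that entry no other of these diagrams contributes. *)
Lemma rho_injective : injective rho.
Proof.
suff H x : rho x = 0 -> x = 0.
  move=> x y E; apply/eqP; rewrite -subr_eq0; apply/eqP/H.
  by rewrite addrC -scaleN1r rho_linear E scaleN1r addNr.
move=> rx; apply/ffunP => d; rewrite [RHS]ffunE; apply/eqP/negPn/negP => xd.
have [d0 xd0 max] : exists2 d0, x d0 != 0 &
    forall e, x e != 0 -> (heights (stack e) <= heights (stack d0))%N.
  by case: (@arg_maxnP _ d (fun e => x e != 0) (fun e => heights (stack e)) xd) =>
    e xe me; exists e.
have [ij e Eij] := stack_loop d0.
have := congr1 (fun M : 'M_k => M ij.1 ij.2) rx.
rewrite !mxE e eqxx => /eqP; rewrite mulf_eq0 -e (negbTE (norm_neq0 _)) /=.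
rewrite -[contour _ _]/(loop ij) (bigD1 d0) //= big1 ?addr0.
  by rewrite mulf_eq0 (negbTE xd0) Eij (negbTE (fev_stack _)).
move=> d1 nd; apply/eqP; rewrite mulf_eq0; apply/negPn/negP; rewrite negb_or.
case/andP => xd1 fd1; have le := max _ xd1.
have [E|ne] := eqVneq (loop ij) (stack d1).
  move/eqP: nd; apply; apply: code_inj.
  rewrite -(steps_stack_path (code_color d1)) -(steps_stack_path (code_color d0)).
  by rewrite -/(stack d1) -E Eij.
by have := fev_loop e fd1 ne; rewrite Eij ltnNge le.
Qed.

(** Induction on the height: the diagram whose highest sequence is [loop (i, j)] has a nonzero entry
    there, and its other nonzero entries are lower, hence can be subtracted. *)
Lemma rho_onto i j : through i = through j -> exists x, rho x = delta_mx i j.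
Proof.
have [b] := ubnP (heights (loop (i, j))); elim: b i j => // b IH i j;
  rewrite ltnS => le_b e.
have [d Ed] := loop_code (ij := (i, j)) e.
have rhoZ c x : rho (c *: x) = c *: rho x.
  have := rho_linear c x 0; have := rho_linear (-1) 0 0.
  by rewrite scaler0 addr0 scaleN1r addNr => ->; rewrite !addr0.
have /fin_all_exists[y Hy] (p : 'I_k * 'I_k) :
    exists x, rho x = (p != (i, j))%:R * rho (delta d) p.1 p.2 *: delta_mx p.1 p.2.
  have [->|np] := eqVneq p (i, j).
    by exists (0 *: 0); rewrite rhoZ mul0r !scale0r.
  rewrite mul1r; have [z|nz] := eqVneq (rho (delta d) p.1 p.2) 0.
    by exists (0 *: 0); rewrite rhoZ z !scale0r.
  have ep : through p.1 = through p.2.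
    by apply/eqP; apply: contraNT nz => /rho_block->.
  have [|//|x Hx] := IH p.1 p.2; last by exists (rho (delta d) p.1 p.2 *: x);
    rewrite rhoZ Hx.
  rewrite -surjective_pairing; apply: leq_trans le_b; rewrite -Ed;
    apply: fev_loop => //.
    by apply: contraNneq nz; rewrite rho_delta ep eqxx -[contour _ _]/(loop p) => ->;
      rewrite mulr0.
  by rewrite Ed; apply: contraNneq np => /loop_inj -> //.
have c0 : rho (delta d) i j != 0.
  rewrite rho_delta e eqxx -e mulf_neq0 ?norm_neq0 // -[contour _ _]/(loop (i, j)).
  by rewrite -Ed fev_stack.
pose s := \sum_p y p.
have rs : rho s = rho (delta d) - rho (delta d) i j *: delta_mx i j.
  have -> : rho s = \sum_p rho (y p).
    have := linear_sum_seq (index_enum _) (fun=> 1) y rho_linear.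
    under eq_bigr do rewrite scale1r.
    by move=> ->; apply: eq_bigr => p _; rewrite scale1r.
  apply/eqP; rewrite eq_sym subr_eq; apply/eqP.
  rewrite {1}[rho (delta d)]matrix_sum_delta pair_big /=.
  rewrite (bigD1 (i, j)) //= addrC; congr (_ + _).
  rewrite [RHS](bigD1 (i, j)) //= [X in X + _]Hy eqxx mul0r scale0r add0r.
  by apply: eq_bigr => p np; rewrite Hy np mul1r.
exists ((rho (delta d) i j)^-1 *: (-1 *: s + delta d)).
rewrite rhoZ rho_linear rs scaleN1r opprB subrK scalerA mulVf // scale1r //.
Qed.

Lemma semisimple_generic : semisimple (@FCmul F m n a).
Proof.
exact: (semisimple_block rho_linear rho_injective rho_mul rho_block rho_onto).
Qed.

End Representation.

(** * The degenerate case *)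

Section BadWord.
Variables (m : nat) (j : 'I_m).

Lemma color_block q r : (r < m)%N ->
  color m (m * q + r) = if odd q then (m.-1 - r)%N else r.
Proof.
move=> lt_r; have m_gt0 : (0 < m)%N by lia.
by rewrite /color mulnC divnMDl // divn_small // addn0 modnMDl modn_small.
Qed.

Lemma word_succ b :
  word m b.+1 = word m b ++ (if odd b then rev (iota 0 m) else iota 0 m).
Proof.
rewrite /word /mkseq mulnS addnC iotaD map_cat add0n; congr (_ ++ _).
rewrite -[X in iota X m]addn0 iotaDl -map_comp.
transitivity [seq if odd b then (m.-1 - r)%N else r | r <- iota 0 m].
  by apply/eq_in_map => r; rewrite mem_iota /= => lt_r; rewrite color_block.
case: odd; last by rewrite map_id.
apply: (@eq_from_nth _ 0%N) => [|i]; rewrite size_map ?size_rev // size_iota => lt_i.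
rewrite (nth_map 0%N) ?size_iota // nth_rev ?size_iota // !nth_iota //; lia.
Qed.

(** Blocks [q] and [2K - 1 - q] have opposite parities, hence opposite directions. *)
Lemma word_double K : word m (K + K) = word m K ++ rev (word m K).
Proof.
have sz b : size (word m b) = (m * b)%N by rewrite size_mkseq.
apply: (@eq_from_nth _ 0%N) => [|i].
  by rewrite size_cat size_rev !sz mulnDr.
rewrite sz => lt_i; rewrite nth_cat sz nth_mkseq //.
have [lt|le] := ltnP i (m * K); first by rewrite nth_mkseq.
rewrite nth_rev ?sz; last by lia.
rewrite nth_mkseq; last by lia.
have m_gt0 : (0 < m)%N by case: (m) j => // -[].
have Ei := divn_eq i m; set q := (i %/ m)%N in Ei; set r := (i %% m)%N in Ei.
have lt_r : (r < m)%N by rewrite ltn_mod.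
have lt_q : (q < K + K)%N by rewrite ltn_divLR // mulnC.
have -> : (m * K - (i - m * K).+1 = m * (K + K - q.+1) + (m.-1 - r))%N by nia.
rewrite Ei mulnC !color_block //; last by lia.
rewrite oddB // oddD addbb /=; case: odd => /=; lia.
Qed.

Definition reach x w y := exists p, is_path tree_nbr x w p /\ last x p = y.

Lemma reach_cat x y z u v : reach x u y -> reach y v z -> reach x (u ++ v) z.
Proof.
move=> [p [pu <-]] [q [qv <-]]; exists (p ++ q).
by rewrite is_path_cat ?(is_path_size pu) // pu last_cat.
Qed.

Lemma reach_push x u : reach x u (rev u ++ x).
Proof.
elim: u x => [|c u IH] x; first by exists [::].
rewrite rev_cons cat_rcons -cat1s; apply: reach_cat (IH _).
by exists [:: c :: x]; split=> //; rewrite /is_path mem_tree_nbr eqxx.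
Qed.

Lemma reach_pop x u : reach (u ++ x) u x.
Proof.
elim: u => [|c u IH]; first by exists [::].
rewrite -[X in reach _ X _]cat1s; apply: reach_cat IH.
by exists [:: u ++ x]; split=> //; rewrite /is_path mem_tree_nbr eqxx orbT.
Qed.

(* Pushing the strings of colour [j] while cancelling all others leads to a
   region with a run of [b] letters [j] after [b] blocks. *)
Lemma reach_run b : (0 < b)%N ->
  exists u, reach [::] (word m b) (u ++ nseq b (j : nat) ++ rev (iota 0 j)).
Proof.
pose hi := iota j.+1 (m - j.+1).
have Em : iota 0 m = iota 0 j ++ (j : nat) :: hi.
  rewrite -{1}(subnKC (ltn_ord j)) -addn1 -addnA iotaD add0n add1n /=.
  by rewrite /hi addn1.
(* The letters above the run are those of the last block that follow [j]: the larger colours after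
   an odd number of blocks, the smaller ones after an even number. *)
case: b => // b _; exists (if odd b.+1 then rev hi else iota 0 j).
elim: b => [|b IH].
  have := reach_push [::] (iota 0 m); rewrite word_succ /word muln0 /=.
  by rewrite {2}Em rev_cat rev_cons cats0 cat_rcons.
rewrite word_succ; apply: reach_cat IH _.
rewrite [odd b.+2]/= negbK; case: (boolP (odd b)) => ob.
  rewrite /= ob /= Em; apply: reach_cat (reach_pop _ _) _.
  apply: (@reach_cat _ (nseq b.+2 (j : nat) ++ rev (iota 0 j)) _ [:: j : nat] hi).
    exact: (reach_push _ [:: j : nat]).
  exact: reach_push.
rewrite /= ob /= Em rev_cat rev_cons cat_rcons; apply: reach_cat (reach_pop _ _) _.
apply: (@reach_cat _ (nseq b.+2 (j : nat) ++ rev (iota 0 j)) _ [:: j : nat] (rev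
  (iota 0 j))).
  exact: (reach_push _ [:: j : nat]).
by have := reach_push (nseq b.+2 (j : nat) ++ rev (iota 0 j)) (rev (iota 0 j));
  rewrite revK.
Qed.

End BadWord.

(** * A necessary condition for semisimplicity *)

Section Nilpotent.
Variables (F : fieldType) (A : vectType F) (mul : A -> A -> A) (one : A).
Hypothesis mul_linl : forall y, linear (mul^~ y).
Hypothesis mul_linr : forall x, linear (mul x).
Hypothesis mulA : forall x y z, mul (mul x y) z = mul x (mul y z).
Hypothesis mul1 : forall x, mul one x = x /\ mul x one = x.

(* A semisimple algebra contains no [y <> 0] with [y A y = 0]: if [y u <> 0]
   for some [u] in a simple left ideal, then [u] lies in [A (y u)], so that
   [y u] lies in [y A y u = 0]; hence [y A = 0]. *)
Lemma semisimple_sandwich y : semisimple mul ->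
  (forall x, mul y (mul x y) = 0) -> y = 0.
Proof.
move=> [k [U [simU _ fullU]]] yAy.
have lin_sum (f : A -> A) (I : Type) (r : seq I) c x : linear f ->
    f (\sum_(i <- r) c i *: x i) = \sum_(i <- r) c i *: f (x i).
  exact: linear_sum_seq.
have lin0 (f : A -> A) : linear f -> f 0 = 0.
  by move=> lf; have := lf (-1) 0 0; rewrite scaler0 addr0 scaleN1r addNr.
have yU i u : u \in U i -> mul y u = 0.
  move=> uU; apply/eqP/negPn/negP => yu0.
  have [idU _ minU] := simU i.
  pose b := vbasis {:A}.
  (* The left ideal generated by [y u], written on a basis. *)
  pose L := (\sum_(l < \dim {:A}) <[mul b`_l (mul y u)]>)%VS.
  have inL x : mul x (mul y u) \in L.
    rewrite (coord_vbasis (memvf x)) (lin_sum (mul^~ _)) //.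
    by apply: memv_sumr => l _; rewrite memvZ ?memv_line.
  have Lin x : x \in L -> exists z, x = mul z (mul y u).
    move/memv_sumP => [v vb ->].
    have /fin_all_exists[c Hc] l : exists c, v l = c *: mul b`_l (mul y u).
      by apply/vlineP; exact: vb.
    exists (\sum_l c l *: b`_l); rewrite (lin_sum (mul^~ _)) //.
    by apply: eq_bigr => l _; rewrite Hc.
  have idL : left_ideal mul L.
    by move=> x w /Lin[z ->]; rewrite -mulA inL.
  have LU : (L <= U i)%VS.
    by apply/subvP => x /Lin[z ->]; apply/idU/idU.
  have [L0|LE] := minU _ idL LU.
    by move: (inL one); rewrite (proj1 (mul1 _)) L0 memv0 (negbTE yu0).
  have [|z Ez] := Lin u; first by rewrite LE.
  have E : mul y (mul z (mul y u)) = mul (mul y (mul z y)) u by rewrite !mulA.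
  by move: yu0; rewrite Ez E yAy (lin0 (mul^~ u)) ?eqxx.
rewrite -(proj2 (mul1 y)).
have : one \in (\sum_(i < k) U i)%VS by rewrite fullU memvf.
case/memv_sumP => v vU ->.
have := lin_sum (mul y) _ (index_enum _) (fun=> 1) v (mul_linr y).
under eq_bigr do rewrite scale1r.
by move=> ->; rewrite big1 // => i _; rewrite (yU i) ?scaler0 // vU.
Qed.

End Nilpotent.

(** * A nonzero element with vanishing sandwiches *)

Section NonSemisimple.
Variables (m K : nat) (j : 'I_m).
Variables (F : numClosedFieldType) (a : 'I_m -> F) (a' : nat -> F).
Hypothesis a'E : forall j : 'I_m, a' j = a j.
Hypothesis K0 : cheb (a j) K = 0.
Local Notation n := (K + K)%N.
Local Notation word := (word m n).
Local Notation mu := (mu a').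
Local Notation nbr := (nbr a').
Local Notation delta := (@delta m n F).
Local Notation mul := (@FCmul F m n a).

Let m_gt0 : (0 < m)%N.
Proof. by case: m j => // -[]. Qed.

Let K_gt0 : (0 < K)%N.
Proof. by case: K K0 => // /eqP; rewrite oner_eq0. Qed.

Let rev_word : rev word = word.
Proof. by rewrite (word_double j) rev_cat revK. Qed.

Lemma nbr_tree x w p : is_path nbr x w p -> is_path tree_nbr x w p.
Proof.
elim: w x p => [|c w IH] x [|y p] //= /andP[].
by rewrite mem_nbr => /and3P[_ _ ->] /IH.
Qed.

Lemma nbr_all_mu x w p : is_path nbr x w p -> all (fun y => mu y != 0) p.
Proof. by elim: w x p => [|c w IH] x [|y p] //= /andP[/nbr_mu-> /IH]. Qed.

(** The first [K] blocks lead to a run of [K] letters [j], a region of weight zero; the other [K]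
    blocks mirror them and lead back. *)
Lemma bad_half_diagram : exists2 D, tev [::] D word &
  exists2 x, x \in stack_path [::] D word & mu x = 0.
Proof.
have [u [p [pw lp]]] := reach_run j K_gt0.
have pp : is_path tree_nbr [::] word (p ++ rev (belast [::] p)).
  rewrite (word_double j) is_path_cat ?(is_path_size pw) // pw /=.
  by apply: is_path_rev => //; exact: tree_nbr_sym.
exists (steps [::] (p ++ rev (belast [::] p))).
  by rewrite tev_steps // last_cat last_rev_belast.
exists (last [::] p).
  rewrite stack_path_steps // mem_cat; case: p pw {lp pp} => [|y p _].
    move/is_path_size; rewrite /= size_mkseq; move: m_gt0 K_gt0; nia.
  by rewrite /= mem_last.
apply/eqP; rewrite mu_eq0 lp weight_cat_eq0 // weight_run_eq0 ?a'E //.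
case E: (rev _) => [|c s] //=; rewrite /run /=.
have : c \in rev (iota 0 j) by rewrite E inE eqxx.
by rewrite mem_rev mem_iota /= add0n => lt; case: eqP => // Ec; move: lt;
  rewrite Ec ltnn.
Qed.

Lemma fev_closed D x w p : tev [::] D w -> size p = size w ->
  fev mu [::] D x p = (last x p == x)%:R * fev mu [::] D x p.
Proof.
move=> tD sp; have := @fev_cat _ _ mu D [::] x p [::] (tev_dyck tD).
by rewrite !cats0 (tev_size tD) => /(_ sp) {1}->; rewrite /= mulr1.
Qed.

Section Sandwich.
Variable D0 : seq bool.
Hypothesis tD0 : tev [::] D0 word.

(* The scalar [<D0| d |h>]: the value of the closed diagram obtained by gluing
   [D0], [d] and the half diagram [h], as a state sum. *)
Definition sandwich (d : diagram m n) (h : seq bool) : F :=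
  \sum_(q <- paths nbr [::] (rev word))
    mu (last [::] q) / mu [::] * ((last [::] q == [::])%:R *
      fev mu [::] D0 [::] q *
      (let p := rev (belast [::] q) in let w := last [::] p in
       \sum_(q' <- paths nbr w (rev word))
         mu (last w q') / mu w * ((last w q' == [::])%:R *
           fev mu [::] (code d) [::] (p ++ q') *
           fev mu [::] h [::] (rev (belast w q'))))).

(** The lower half [D0] of [e'], the diagram [d] and the upper half [h] of [e] close up to a scalar;
    the halves [h'] and [D0] that remain form [e']. *)
Lemma sandwich_mul d h : tev [::] h word ->
  forall (e e' : diagram m n) h', code e = h ++ D0 -> tev [::] h' word ->
    code e' = h' ++ D0 ->
  mul (delta e') (mul (delta d) (delta e)) = sandwich d h *: delta e'.
Proof.
move=> th e e' h' Ee th' Ee'.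
have t1 := code_color d.
have t2 : tev [::] h (rev (rev word) ++ [::]) by rewrite revK cats0.
have [g [es [tg sub Tid fid]]] := compose_codes (@nbr_sym _ a') (@nbr_uniq _ a')
  (@nbr_mu _ a') (@mu_sum _ a') t1 t2.
have t3 : tev [::] D0 ([::] ++ rev word) by rewrite rev_word.
have t4 : tev [::] g (rev (rev word) ++ [::]) by rewrite revK.
have [g' [es' [tg' sub' Tid' fid']]] := compose_codes (@nbr_sym _ a') (@nbr_uniq _ a')
  (@nbr_mu _ a') (@mu_sum _ a') t3 t4.
have {tg'} g'0 : g' = [::] by apply: size0nil; rewrite (tev_size tg').
rewrite {}g'0 in Tid' fid'.
have tg0 : tev [::] g word by rewrite cats0 in tg.
have [eg Eg] : exists eg : diagram m n, code eg = g ++ D0.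
  apply: code_ex; rewrite (tev_cat _ _ _ (tev_dyck tg0)) ?(tev_size tg0) //.
  by rewrite tg0 rev_word.
have size_h h1 bs : tev [::] h1 word -> size bs = size word -> size bs = size h1.
  by move=> /tev_size-> ->.
have st1 : stacks d e eg es.
  split=> // L bs br uL ls lr; have sbs := is_labelling_size ls.
  rewrite Eg (tev_cat _ _ _ (tev_dyck tg0) (size_h _ g bs tg0 sbs)) -(mulnb
    (tev [::] g bs)) mulnA.
  have := Tid L bs [::] uL ls isT; rewrite cats0 => <-; rewrite big_distrl /=.
  apply: eq_big_seq => b; rewrite mem_paths is_labellingE => /is_labelling_size sb.
  have {}sb : size (rev b) = size word by rewrite size_rev sb size_rev.
  rewrite Ee (tev_cat _ _ _ (tev_dyck th) (size_h _ h _ th sb)).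
  by rewrite cats0 mulnb andbA.
have st2 : stacks e' eg e' es'.
  split=> // L bs br uL ls lr; have sbs := is_labelling_size ls.
  have := Tid' L [::] [::] uL isT isT; rewrite /= muln1 => <-.
  rewrite Ee' (tev_cat _ _ _ (tev_dyck th') (size_h _ h' bs th' sbs)) big_distrl /=.
  apply: eq_big_seq => b; rewrite mem_paths is_labellingE => /is_labelling_size sb.
  have {}sb : size (rev b) = size word by rewrite size_rev sb size_rev.
  rewrite (tev_cat _ _ _ (tev_dyck th') (size_h _ h' bs th' sbs)).
  rewrite Eg (tev_cat _ _ _ (tev_dyck tg0) (size_h _ g _ tg0 sb)) cats0.
  by rewrite -!mulnb; ring.
rewrite (FCmul_delta m_gt0 a'E st1) FCmulZr (FCmul_delta m_gt0 a'E st2) scalerA.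
congr (_ *: _); rewrite /sandwich.
have mu1 : mu [::] != 0 by rewrite mu_eq0 oner_neq0.
have := fid' [::] [::] [::] isT isT mu1; rewrite /= mulr1 => <-.
rewrite mulr_sumr; apply: eq_big_seq => q; rewrite mem_paths rev_word => wq.
case: eqP => [lq|_]; last by rewrite !mul0r !mulr0.
rewrite mul1r mulrCA; congr (_ * _); rewrite mulrCA; congr (_ * _).
have pq := is_path_rev (@nbr_sym _ a') wq; rewrite lq rev_word in pq.
have := fid [::] (rev (belast [::] q)) [::] pq isT _.
rewrite /= !cats0 => <-; last exact: (mu_last (@nbr_mu _ a') pq mu1).
by rewrite rev_word; apply: eq_bigr => q' _; rewrite cats0.
Qed.

(** The half diagram enters the state sum only through its values on region sequences. Those on
    sequences that are not closed vanish, and the others cancel in the combination. *)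
Lemma sandwich_kernel (I : finType) (v : I -> F) (h : I -> seq bool) d :
  (forall i, tev [::] (h i) word) ->
  (forall p, is_path nbr [::] word p -> last [::] p = [::] ->
     \sum_i v i * fev mu [::] (h i) [::] p = 0) ->
  \sum_i v i * sandwich d (h i) = 0.
Proof.
move=> th ker; rewrite /sandwich.
under eq_bigr do rewrite mulr_sumr.
rewrite exchange_big /= big1 // => q _.
set w := last [::] (rev (belast [::] q)).
under eq_bigr do rewrite !mulr_sumr.
rewrite exchange_big /= big_seq big1 // => q'; rewrite mem_paths => wq'.
case: (last w q' =P [::]) => [lq'|_]; last first.
  by rewrite big1 // => i _; rewrite !mul0r !mulr0.
have pr := is_path_rev (@nbr_sym _ a') wq'.
have lr := last_rev_belast w q'; rewrite lq' revK in pr lr.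
set r := rev (belast w q') in pr lr *.
have kr : \sum_i v i * fev mu [::] (h i) [::] r = 0.
  have [w0|w0] := eqVneq w [::]; first by apply: ker => //; rewrite lr w0.
  rewrite big1 // => i _; rewrite (fev_closed _ (th i)) ?(is_path_size pr) //.
  by rewrite lr (negbTE w0) mul0r mulr0.
set c := (X in _ = X); rewrite -[RHS](mulr0 (mu (last [::] q) / mu [::] *
  ((last [::] q == [::])%:R * fev mu [::] D0 [::] q) * (mu [::] / mu w) *
  fev mu [::] (code d) [::] (rev (belast [::] q) ++ q'))) -[in RHS]kr mulr_sumr.
apply: eq_bigr => i _; rewrite mul1r lq'.
by move: (_%:R) (_ / _) (_ / _) => b s t; ring.
Qed.

End Sandwich.

Theorem not_semisimple : ~ semisimple mul.
Proof.
have [D0 tD0 [x0 x0D mu0]] := bad_half_diagram => ss.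
pose ps := [seq p <- paths nbr [::] word | last [::] p == [::]].
(* One half diagram for each allowed closed sequence, and one more: [D0] is new, since its highest
   sequence meets a region of weight zero. *)
pose hs := D0 :: map (steps [::]) ps.
have psP p : p \in ps -> is_path nbr [::] word p /\ last [::] p = [::].
  by rewrite mem_filter mem_paths => /andP[/eqP].
have ths h : h \in hs -> tev [::] h word.
  rewrite inE => /predU1P[->//|/mapP[p /psP[pw lp] ->]].
  by rewrite tev_steps ?lp //; exact: nbr_tree pw.
have uhs : uniq hs.
  rewrite /= map_inj_in_uniq => [|p q /psP[pw _] /psP[qw _] E]; last first.
    by rewrite -(stack_path_steps (nbr_tree pw)) E (stack_path_steps (nbr_tree qw)).
  rewrite filter_uniq ?andbT; last by apply: paths_uniq => c y; exact: nbr_uniq.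
  apply/mapP => -[p /psP[pw _] E]; move: x0D.
  rewrite E (stack_path_steps (nbr_tree pw)) => /(allP (nbr_all_mu pw)).
  by rewrite mu0 eqxx.
pose r := size ps; pose h (i : 'I_r.+1) := nth [::] hs i.
have shs : size hs = r.+1 by rewrite /= size_map.
have th i : tev [::] (h i) word by apply/ths/mem_nth; rewrite shs.
have h_inj : injective h.
  by move=> i i' /eqP; rewrite nth_uniq ?shs // => /eqP/val_inj.
(* There are [r + 1] half diagrams and only [r] closed sequences, so the rows are dependent. *)
pose M : 'M[F]_(r.+1, r) := \matrix_(i, l) fev mu [::] (h i) [::] (nth [::] ps l).
have [v vM v0] : exists2 v : 'rV_r.+1, v *m M = 0 & v != 0.
  have /rowV0Pn[v /sub_kermxP vM v0] : kermx M != 0.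
    by rewrite -mxrank_eq0 mxrank_ker -lt0n subn_gt0 ltnS rank_leq_col.
  by exists v.
have /fin_all_exists[e He] i : exists d : diagram m n, code d = h i ++ D0.
  apply: code_ex; rewrite (tev_cat _ _ _ (tev_dyck (th i))) ?(tev_size (th i)) //.
  by rewrite th rev_word.
have e_inj : injective e.
  move=> i i' /(congr1 (fun d : diagram m n => code d)); rewrite !He => /eqP.
  rewrite eqseq_cat ?(tev_size (th _)) // => /andP[/eqP/h_inj]; by [].
pose y : FC F m n := \sum_i v 0 i *: delta (e i).
have y_eq i : y (e i) = v 0 i.
  rewrite sum_ffunE (bigD1 i) //= big1 => [|l nl]; rewrite FC_scaleE ffunE.
    by rewrite eqxx mulr1 addr0.
  by rewrite (inj_eq e_inj) eq_sym (negbTE nl) mulr0.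
have [one H1] := FCmul_unit n m_gt0 a'E.
have y0 : y = 0.
  apply: (semisimple_sandwich (FCmul_linearl a (n := n)) (FCmul_linearr a (n := n))
    (FCmulA m_gt0 a'E (n := n)) H1 ss).
  apply: (@linear_ext m n F _ (fun x => mul y (mul x y)) (fun=> 0)) => [c x z|c x z|d].
  - by rewrite FCmul_linearl FCmul_linearr.
  - by rewrite scaler0 addr0.
  rewrite FCmul_sumr FCmul_sumr.
  transitivity (\sum_l \sum_i (v 0 i * (v 0 l * sandwich D0 d (h l))) *: delta (e i)).
    apply: eq_bigr => l _; rewrite FCmul_suml scaler_sumr; apply: eq_bigr => i _.
    rewrite (sandwich_mul tD0 d (th l) (He l) (th i) (He i)) !scalerA.
    congr (_ *: _); ring.
  rewrite exchange_big /= big1 // => i _; rewrite -scaler_suml -mulr_sumr.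
  rewrite (sandwich_kernel D0 d th) ?mulr0 ?scale0r // => p pw lp.
  have pps : p \in ps by rewrite mem_filter lp eqxx mem_paths.
  have lt_p : (index p ps < r)%N by rewrite index_mem.
  have := congr1 (fun N : 'rV_r => N 0 (Ordinal lt_p)) vM; rewrite !mxE => E.
  by rewrite -[RHS]E; apply: eq_bigr => l _; rewrite mxE /= nth_index.
case/eqP: v0; apply/rowP => i; rewrite -y_eq y0 mxE.
by rewrite ffunE.
Qed.

End NonSemisimple.

(** * Roots of the Chebyshev polynomials *)

Lemma cheb_rmorph (F G : fieldType) (f : {rmorphism F -> G}) x k :
  cheb (f x) k = f (cheb x k).
Proof.
suff: cheb (f x) k = f (cheb x k) /\ cheb (f x) k.+1 = f (cheb x k.+1) by case.
elim: k => [|k [IH1 IH2]]; first by rewrite /= rmorph1.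
by split=> //; rewrite !chebSS rmorphB rmorphM IH1 IH2.
Qed.

Section ChebyshevRoots.
Variable R : realType.
Implicit Type r : rat.

Lemma cheb_sin (t : R) k : sin t * cheb (2 * cos t) k = sin (k.+1%:R * t).
Proof.
suff: sin t * cheb (2 * cos t) k = sin (k.+1%:R * t) /\
  sin t * cheb (2 * cos t) k.+1 = sin (k.+2%:R * t) by case.
elim: k => [|k [IH1 IH2]].
  rewrite /= mulr1 mul1r; split=> //.
  by rewrite (_ : 2%:R * t = t + t) ?sinD; ring.
split=> //; rewrite chebSS mulrBr IH1 mulrCA IH2.
rewrite (_ : k.+3%:R * t = k.+2%:R * t + t); last by rewrite -[in LHS]natr1; ring.
rewrite (_ : k.+1%:R * t = k.+2%:R * t - t); last by rewrite -[in RHS]natr1; ring.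
by rewrite !sinD sinN cosN; ring.
Qed.

Lemma sin_int (z : int) : sin (pi * z%:~R) = 0 :> R.
Proof.
have H n : sin (pi * n%:R) = 0 :> R.
  by rewrite mulr_natr -[pi *+ n]add0r (alternatingn (@sinDpi R)) sin0 mulr0.
case: z => n; first exact: H.
by rewrite NegzE mulrNz mulrN sinN H oppr0.
Qed.

(** Modulo an integer, [r] has a representative in the open interval from [0] to [1], and there the
    sine is positive. *)
Lemma sin_rat_neq0 r : r \isn't a Num.int -> sin (pi * ratr r) != 0 :> R.
Proof.
move=> rn; have /andP[le lt] := floor_itv r; set z := Num.floor r in le lt.
have lt_z : z%:~R < r.
  by rewrite lt_neqAle le andbT; apply: contraNneq rn => <-; exact: intr_int.
pose f : R := ratr (r - z%:~R).
have f0 : 0 < f by rewrite ltr0q subr_gt0.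
have f1 : f < 1.
  rewrite -[1](ratr_nat R 1) ltr_rat ltrBlDr addrC.
  by rewrite intrD in lt.
have -> : pi * ratr r = pi * f + pi * z%:~R :> R.
  by rewrite /f rmorphB /= ratr_int; ring.
rewrite sinD sin_int mulr0 addr0 mulf_neq0 //.
  rewrite gt_eqF // sin_gt0_pi // mulr_gt0 ?pi_gt0 //=.
  by rewrite -[X in _ < X]mulr1 ltr_pM2l // pi_gt0.
have := cos2Dsin2 (pi * z%:~R : R); rewrite sin_int expr0n addr0.
by apply: contra_eq_neq => ->; rewrite expr0n eq_sym oner_neq0.
Qed.

Lemma cheb_root r : r \isn't a Num.int ->
  exists k, cheb (2 * cos (pi * ratr r) : R) k = 0.
Proof.
(* For [r = p / q] in lowest terms and [k = q - 1], [cheb_sin] gives the numerator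
   [sin (p * pi) = 0]. *)
move=> rn; exists `|denq r|.-1%N.
apply/eqP; have := sin_rat_neq0 rn => s0.
rewrite -(mulrI_eq0 _ (lregP s0)) cheb_sin prednK ?absz_gt0 ?denq_neq0 //.
have E : `|denq r|%:R * ratr r = (numq r)%:~R :> R.
  rewrite -(ratr_nat R) -(ratr_int R) -rmorphM; congr (ratr _).
  by rewrite numqE mulrC pmulrn absz_denq.
by rewrite mulrCA E sin_int.
Qed.

Fixpoint cheb_poly (F : fieldType) (k : nat) : {poly F} :=
  match k with
  | 0 => 1
  | k'.+1 => if k' is k''.+1 then cheb_poly F k' * 'X - cheb_poly F k'' else 'X
  end.

Lemma horner_cheb_poly (F : fieldType) k (x : F) : (cheb_poly F k).[x] = cheb x k.
Proof.
suff: (cheb_poly F k).[x] = cheb x k /\ (cheb_poly F k.+1).[x] = cheb x k.+1 by case.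
elim: k => [|k [IH1 IH2]]; first by rewrite hornerX hornerE.
split=> //; rewrite chebSS -IH1 -IH2 [cheb_poly F k.+2]/(_ * 'X - _).
by rewrite hornerD hornerN hornerMX mulrC.
Qed.

Lemma size_cheb_poly (F : fieldType) k : size (cheb_poly F k) = k.+1.
Proof.
suff: size (cheb_poly F k) = k.+1 /\ size (cheb_poly F k.+1) = k.+2 by case.
elim: k => [|k [IH1 IH2]]; first by rewrite size_poly1 size_polyX.
split=> //; rewrite [cheb_poly F k.+2]/(_ * 'X - _).
have nz : cheb_poly F k.+1 != 0 by rewrite -size_poly_gt0 IH2.
by rewrite size_polyDl size_mulX ?IH2 // size_polyN IH1.
Qed.

(* [cheb_poly k] has degree [k], so the [k] distinct values
   [2 cos (pi t / (k + 1))] for [0 < t <= k] are all its roots. *)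
Lemma cheb_eq0 (z : R[i]) k : cheb z k = 0 ->
  exists2 r : rat, r \isn't a Num.int & z = (2 * cos (pi * ratr r))%:C.
Proof.
move=> z0; pose q (t : nat) : rat := t%:R / k.+1%:R.
pose c t : R[i] := (2 * cos (pi * ratr (q t)))%:C.
have q01 t : t \in iota 1 k -> 0 < q t < 1.
  rewrite mem_iota => /andP[t0 tk]; rewrite /q divr_gt0 ?ltr0n //=.
  by rewrite ltr_pdivrMr ?ltr0n // mul1r ltr_nat.
have qn t : t \in iota 1 k -> q t \isn't a Num.int.
  move=> /q01/andP[q0 q1]; apply/negP => /intrP[x Ex]; move: q0 q1.
  by rewrite Ex ltr0z -[1]/(1%:~R) ltr_int; lia.
have pq01 t : t \in iota 1 k -> pi * ratr (q t) \in `[0, pi :> R].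
  move=> /q01/andP[/ltW q0 /ltW q1]; rewrite in_itv /=; apply/andP; split.
    by rewrite mulr_ge0 ?pi_ge0 ?ler0q.
  have : ratr (q t) <= ratr 1 :> R by rewrite ler_rat.
  by rewrite rmorph1 => le1; rewrite -[leRHS]mulr1 ler_pM2l ?pi_gt0.
have c_inj : {in iota 1 k &, injective c}.
  move=> t u tk uk; rewrite /c => /complexI /(mulfI _) E.
  have /(mulfI (lt0r_neq0 (pi_gt0 R))) : pi * ratr (q t) = pi * ratr (q u) :> R.
    by apply: cos_inj; rewrite ?pq01 //; apply: E; rewrite pnatr_eq0.
  move=> /fmorph_inj /(mulIf _) F; apply/eqP; rewrite -(eqr_nat rat).
  by apply/eqP/F; rewrite invr_eq0 pnatr_eq0.
have c_root t : t \in iota 1 k -> cheb (c t) k = 0.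
  move=> tk; rewrite /c (cheb_rmorph (real_complex R)); apply/eqP.
  have s0 := sin_rat_neq0 (qn _ tk).
  rewrite fmorph_eq0 -(mulrI_eq0 _ (lregP s0)) cheb_sin mulrCA.
  rewrite -(ratr_nat R) -rmorphM /q [_%:R * (_ / _)]mulrC divfK ?pnatr_eq0 //.
  by rewrite rmorph_nat -[_%:R]/((Posz t)%:~R) sin_int.
case: (boolP (z \in map c (iota 1 k))) => [/mapP[t tk ->]|nz].
  by exists (q t) => //; exact: qn.
have p0 : cheb_poly R[i] k != 0 by rewrite -size_poly_gt0 size_cheb_poly.
(* A further root [z] would give [k + 1] distinct roots in degree [k]. *)
have := @max_poly_roots _ _ (z :: map c (iota 1 k)) p0.
rewrite size_cheb_poly /= size_map size_iota ltnn nz map_inj_in_uniq ?iota_uniq //.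
rewrite /root horner_cheb_poly z0 eqxx /= => /(_ _ isT) H.
exfalso; suff: false by []; apply: H.
apply/allP => _ /mapP[t tk ->]; rewrite horner_cheb_poly c_root //.
Qed.

End ChebyshevRoots.

Theorem corollary4p5 (R : realType) (m : nat) (m_ge1 : (1 <= m)%N)
    (a : 'I_m -> R[i]) :
  (forall n : nat, (1 <= n)%N -> semisimple (@FCmul R[i] m n a)) <->
  (forall j : 'I_m,
     ~ (exists2 r : rat, r \isn't a Num.int
                       & a j = (2 * cos (pi * ratr r))%:C)).
Proof.
(* Colours out of range get the parameter of the first colour, so that every value of [a'] is one of
   [a] and is covered by the assumption on [a]. *)
pose a' c := a (odflt (Ordinal m_ge1) (insub c)).
have a'E (j : 'I_m) : a' j = a j by rewrite /a' valK.
split=> [ss j [r rn aj]|good n _].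
  have [k k0] := cheb_root R rn.
  have ck : cheb (a j) k = 0 by rewrite aj (cheb_rmorph (real_complex R)) k0 rmorph0.
  apply: (@not_semisimple m k j R[i] a a' a'E ck); apply: ss.
  (* The number [k + k] of blocks is positive since [cheb (a j) 0 = 1]. *)
  by rewrite addn_gt0 orbb; case: k ck {k0} => // /eqP; rewrite oner_eq0.
apply: (@semisimple_generic m n m_ge1 R[i] a a' a'E) => c k.
by apply/eqP => /cheb_eq0; exact: good.
Qed.
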